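(* For any (stationary) binary renewal process $\{X_n\}$ with run-length distribution $\{p_k\}_{k\ge0}$, and for almost every sequence of observations $X_0^\infty=(X_0,X_1,\ldots)$, there is a set of indices $D(X_0^\infty)\subset\{0,1,\ldots\}$ such that $$\lim_{n\to\infty}\frac{|D(X_0^\infty)\cap\{0,1,\ldots,n\}|}{n+1}=1,$$ $$\lim_{n\in D(X_0^\infty),\,n\to\infty}\bigl|\tilde h_n(X_0,\ldots,X_n)-\theta_n\bigr|=0,$$ and $$\lim_{n\in D(X_0^\infty),\,n\to\infty}\sum_{l=0}^\infty\left|\tilde p_l(X_0^n)-\frac{p_{l+\tau(X_0^n)}}{\sum_{i=\tau(X_0^n)}^\infty p_i}\right|=0,$$ where $\tilde h_n$ and $\tilde p_l$ are the estimators defined in the context.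
   Context: **Binary renewal process.** Let $\{p_k\}_{k=0}^\infty$ be a probability distribution on $\{0,1,2,\ldots\}$ with $\mu=\sum_{k}kp_k<\infty$. Consider the Markov chain $\{M_n\}$ on $\{0,1,2,\ldots\}$ with transition probabilities $p_{i,i-1}=1$ for $i\ge1$ and $p_{0,i}=p_i$ for $i\ge 0$, started from its unique stationary distribution (which gives mass $1/(1+\mu)$ to state $0$). The binary renewal process is $X_n=0$ if $M_n=0$ and $X_n=1$ otherwise. It is stationary, and may be regarded as a two-sided process $\{X_n\}_{n\in\mathbb Z}$; $p_k$ is the conditional probability that a run of exactly $k$ ones follows a given zero. **Notation.** $X_i^j=(X_i,\ldots,X_j)$. - $\psi=\min\{t\ge0: X_t=0\}$ is the position of the first zero. - For $n\ge\psi$, $\tau(X_0^n)$ is the $t\ge0$ such that $X_{n-t}=0$ and $X_i=1$ for all $n-t<i\le n$ (time since the last zero). - $\sigma_i=\max\{l\ge0: X_j=1\text{ for all } i<j\le i+l\}$. - $\theta_n=E(\sigma_n\mid X_0^n)$. On $\{n\ge\psi\}$ one has $\theta_n=\dfrac{\sum_{k=0}^\infty k\,p_{k+\tau(X_0^n)}}{\sum_{k=\tau(X_0^n)}^\infty p_k}$ (for $n<\psi$, $\theta_n$ may be infinite). **Estimators.** For $n\ge\psi$, $$\tilde h_n(X_0^n)=\frac{\sum_{i=\psi}^{n-1}\sigma_i\,I_{\{\tau(X_0^i)=\tau(X_0^n)\}}}{|\{\psi\le i\le n-1:\tau(X_0^i)=\tau(X_0^n)\}|},\qquad \tilde p_l(X_0^n)=\frac{\sum_{i=\psi}^{n-1}I_{\{\tau(X_0^i)=\tau(X_0^n),\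 \sigma_i=l\}}}{|\{\psi\le i\le n-1:\tau(X_0^i)=\tau(X_0^n)\}|}\quad(l\ge0),$$ with the convention that these are set to $0$ when the denominator is zero. Here $I$ denotes the indicator function. Values for $n<\psi$ are irrelevant to the limits. *)

(* Defs.v *)
(* MathComp / MathComp-Analysis *)
From HB Require Import structures.
From mathcomp Require Import all_boot all_order all_algebra.
From mathcomp Require Import all_classical all_reals all_analysis.
Set Implicit Arguments.
Unset Strict Implicit.
Unset Printing Implicit Defensive.
Import Order.TTheory GRing.Theory Num.Theory.
Import numFieldNormedType.Exports.
Local Open Scope classical_set_scope.
Local Open Scope ring_scope.

Section RenewalProcess.
Context {R : realType}.
Implicit Types (p pi : nat -> R) (Q : nat -> nat -> R).

Definition prob_dist p :=
  (forall k, 0 <= p k) /\ (\sum_(0 <= k <oo) (p k)%:E = 1)%E.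

Definition finite_mean p := (\sum_(0 <= k <oo) (k%:R * p k)%:E < +oo)%E.

Definition renewal_kernel p (i j : nat) : R :=
  if i is i'.+1 then (j == i')%:R else p j.

Definition stationary_dist Q pi :=
  prob_dist pi /\
  forall j, (\sum_(0 <= i <oo) (pi i * Q i j)%:E = (pi j)%:E)%E.

Section Process.
Context {d : measure_display} {T : measurableType d} (P : probability T R).

(* The last clause is P(M_(n+1) = m_(n+1) | M_0 = m_0, ..., M_n = m_n)
   = Q m_n m_(n+1), multiplied out to cover conditioning events of mass 0. *)
Definition markov_chain Q pi (M : nat -> {RV P >-> nat}) :=
  (forall i, P [set w | M 0%N w = i] = (pi i)%:E) /\
  forall (n : nat) (m : nat -> nat),
    (P [set w | forall i, (i <= n.+1)%N -> M i w = m i] =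
     P [set w | forall i, (i <= n)%N -> M i w = m i] *
       (Q (m n) (m n.+1))%:E)%E.

(* Binary processes are bool-valued: true stands for 1 and false for 0. *)
Definition binary_renewal_process p (X : nat -> T -> bool) :=
  exists (pi : nat -> R) (M : nat -> {RV P >-> nat}),
    [/\ stationary_dist (renewal_kernel p) pi,
        markov_chain (renewal_kernel p) pi M &
        forall n w, X n w = (M n w != 0%N)].

End Process.

Section Trajectory.
Implicit Types (x : nat -> bool) (n i l t : nat).

(* Default 0 on the all-ones trajectory. *)
Definition psi x : nat :=
  xget 0%N [set t | ~~ x t /\ forall s, (s < t)%N -> x s].

(* Meaningful for psi x <= n; default 0 when x_0, ..., x_n are all ones. *)
Definition tau x n : nat :=
  xget 0%N [set t | [/\ (t <= n)%N, ~~ x (n - t)%N &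
                        forall i, (n - t < i <= n)%N -> x i]].

(* The supremum is a maximum unless every entry after i is a one, in which
   case it is +oo. *)
Definition sigma x i : \bar R :=
  ereal_sup [set l%:R%:E | l in
    [set l : nat | forall j, (i < j <= i + l)%N -> x j]].

Definition matches x n : nat :=
  (\sum_(psi x <= i < n) (tau x i == tau x n))%N.

(* est_mean x n and est_prob x n l depend only on x_0, ..., x_n: if
   psi x <= i < n and tau x i = tau x n, then the zero at n - tau x n lies
   strictly after i, so that sigma x i is determined by x_0, ..., x_n. *)
Definition est_mean x n : \bar R :=
  if matches x n == 0%N then 0%E else
  ((\sum_(psi x <= i < n | tau x i == tau x n) sigma x i) *
     ((matches x n)%:R^-1)%:E)%E.

Definition est_prob x n l : R :=
  if matches x n == 0%N then 0 else
  (\sum_(psi x <= i < n) ((tau x i == tau x n) && (sigma x i == l%:R%:E)))%:R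
    / (matches x n)%:R.

End Trajectory.

Definition tail_prob p (t : nat) : R := fine (\sum_(t <= i <oo) (p i)%:E)%E.

Section Residual.
Context {d : measure_display} {T : measurableType d} (P : probability T R).
Variable X : nat -> T -> bool.

Definition traj (w : T) : nat -> bool := fun n => X n w.

Definition atom (n : nat) (w : T) : set T :=
  [set v | forall i, (i <= n)%N -> X i v = X i w].

(* The conditional expectation of Y given (X_0, ..., X_n): the conditioning
   vector takes finitely many values, so this is the mean of Y over the event
   that it takes the value observed at w. *)
Definition cond_exp (Y : T -> \bar R) (n : nat) (w : T) : \bar R :=
  ((\int[P]_(v in atom n w) Y v) * ((fine (P (atom n w)))^-1)%:E)%E.

Definition theta (n : nat) : T -> \bar R :=
  cond_exp (fun v => sigma (traj v) n) n.

End Residual.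

End RenewalProcess.

(* Main.v *)
(** Write [m i] for the chain along a fixed trajectory. The chain counts down
deterministically between zeros, so [sigma] at [i] is [m i.+1], and at a time
[n] with [tau = t] the estimators are the residual frequencies and the
residual mean at age [t] of the empirical law of the run lengths opened by the
zeros before the last zero [n - t]. If these empirical laws converge to [p] in
the distance weighted by [k + 1], the errors tend to 0 along [tau = t] for
each fixed [t]; since the times with [tau > K] have upper density tending to 0
with [K], a diagonal choice gives [D].

Two almost sure facts are enough for that convergence. The number of runs of
length [k] minus [p k] times the number of zeros is a sum of bounded orthogonal
differences, hence o(n). And a maximal inequality for the stationary chain
(interval covering) yields, for each [q], a level [K] such that for every [n]
at most [n / q] of the first [n] states exceed [K]; this bounds the density of
zeros from below and makes the run lengths uniformly integrable. *)

Require Import Defs.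
From HB Require Import structures.
From mathcomp Require Import all_boot all_order all_algebra.
From mathcomp Require Import all_classical all_reals all_analysis.
From mathcomp Require Import measurable_realfun zify ring lra.
Import Order.TTheory GRing.Theory Num.Theory.
Import numFieldNormedType.Exports.
Set Implicit Arguments.
Unset Strict Implicit.
Unset Printing Implicit Defensive.
Local Open Scope classical_set_scope.
Local Open Scope ring_scope.

(** * Trajectories of the chain *)

Definition descends (m : nat -> nat) :=
  forall i, (0 < m i)%N -> m i.+1 = (m i).-1.

Definition ones_of (m : nat -> nat) : nat -> bool := fun n => m n != 0%N.

Definition zeros (m : nat -> nat) (n : nat) : nat :=
  (\sum_(0 <= z < n) (m z == 0))%N.

Definition runs (m : nat -> nat) (k n : nat) : nat :=
  (\sum_(0 <= z < n) ((m z == 0) && (m z.+1 == k)))%N.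

Definition above (m : nat -> nat) (K n : nat) : nat :=
  (\sum_(0 <= i < n) (K < m i))%N.

Section Trajectory.
Variable m : nat -> nat.
Hypothesis md : descends m.
Let x := ones_of m.

Lemma descends_sub i j : (j <= m i)%N -> m (i + j)%N = (m i - j)%N.
Proof.
elim: j => [|j IHj] ltj; first by rewrite addn0 subn0.
have e := IHj (ltnW ltj).
by rewrite addnS md e; lia.
Qed.

Lemma exists_zero i : exists2 z, (i <= z)%N & m z = 0%N.
Proof.
exists (i + m i)%N; first exact: leq_addr.
by rewrite descends_sub // subnn.
Qed.

(** The first zero strictly after [i] is at [i.+1 + m i.+1], since the chain counts down to it.
    Hence [sigma] at [i] is [m i.+1], whether or not [i] is itself a zero. *)
Lemma ones_descend i l :
  (forall j, (i < j <= i + l)%N -> x j) <-> (l <= m i.+1)%N.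
Proof.
split=> [xj|lm j /andP[ij jl]].
  rewrite leqNgt; apply/negP => ml.
  have := xj (i.+1 + m i.+1)%N; rewrite /x /ones_of descends_sub // subnn eqxx.
  by move=> /(_ ltac:(lia)).
rewrite /x /ones_of; have -> : j = (i.+1 + (j - i.+1))%N by lia.
by rewrite descends_sub; lia.
Qed.

Lemma sigma_descends (R : realType) i : sigma x i = (m i.+1)%:R%:E :> \bar R.
Proof.
apply/eqP; rewrite eq_le; apply/andP; split.
  apply: ge_ereal_sup => _ [l /= /ones_descend lm <-].
  by rewrite lee_fin ler_nat.
by apply: ereal_sup_ubound; exists (m i.+1) => //=; apply/ones_descend.
Qed.

Lemma psiP : ~~ x (psi x) /\ forall s, (s < psi x)%N -> x s.
Proof.
apply: (@xgetPex _ 0%N [set t | ~~ x t /\ forall s, (s < t)%N -> x s]).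
have [z _ z0] := exists_zero 0.
have ex : exists z, ~~ x z by exists z; rewrite /x /ones_of z0.
case: (ex_minnP ex) => t xt tmin; exists t; split=> // s st.
by apply: contraT => /tmin; rewrite leqNgt st.
Qed.

Lemma psi_le i : (psi x <= i)%N <-> exists2 z, (z <= i)%N & m z = 0%N.
Proof.
have [xpsi psimin] := psiP; split=> [psii|[z zi z0]].
  by exists (psi x) => //; apply/eqP; move: xpsi; rewrite negbK.
rewrite leqNgt; apply/negP => ipsi.
by have := psimin z (leq_ltn_trans zi ipsi); rewrite /x /ones_of z0.
Qed.

Lemma tau_spec i : (psi x <= i)%N ->
  [/\ (tau x i <= i)%N, m (i - tau x i)%N = 0%N &
      forall j, (i - tau x i < j <= i)%N -> x j].
Proof.
move=> /psi_le[z zi z0].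
suff: [/\ (tau x i <= i)%N, ~~ x (i - tau x i)%N &
      forall j, (i - tau x i < j <= i)%N -> x j].
  by case=> ? /negPn/eqP.
apply: (@xgetPex _ 0%N [set t | [/\ (t <= i)%N, ~~ x (i - t)%N &
                        forall j, (i - t < j <= i)%N -> x j]]).
have ex : exists t, (t <= i)%N && ~~ x (i - t)%N.
  by exists (i - z)%N; rewrite leq_subr subKn // /x /ones_of z0.
case: (ex_minnP ex) => t /andP[ti xt] tmin; exists t; split=> // j /andP[tj ji].
apply: contraT => xj; have := tmin (i - j)%N.
by rewrite leq_subr subKn // xj => /(_ isT); lia.
Qed.

(** Two candidate ages cannot coexist: the later of the two zeros would lie in the block of ones
    following the earlier one. The last condition replaces that block by a bound on the run
    length. *)
Lemma tau_eqP i t : (psi x <= i)%N -> (tau x i == t) <->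
  [/\ (t <= i)%N, m (i - t)%N = 0%N & (t <= m (i - t).+1)%N].
Proof.
move=> psii; have [ti z1 x1] := tau_spec psii.
split=> [/eqP <-|[ti' z2 tm]].
  split=> //; apply/ones_descend => j; rewrite subnK //; exact: x1.
move/ones_descend: tm; rewrite subnK // => x2.
apply/eqP; case: (ltngtP (tau x i) t) => // h.
  by have := x2 (i - tau x i)%N ltac:(lia); rewrite /x /ones_of z1.
by have := x1 (i - t)%N ltac:(lia); rewrite /x /ones_of z2.
Qed.

(* A position [i] with [tau x i = t] is [z + t] for the zero [z] opening its
   run, a run of length at least [t]; before the last zero [n - tau x n] this
   is a bijection onto the runs of length at least [t]. *)
Lemma sum_matches (V : nmodType) (n : nat) (F : nat -> V) : (psi x <= n)%N ->
  \sum_(psi x <= i < n | tau x i == tau x n) F (m i.+1) =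
  \sum_(0 <= z < n - tau x n | (m z == 0%N) && (tau x n <= m z.+1)%N)
     F (m z.+1 - tau x n)%N.
Proof.
move=> psin; have [tn z1 _] := tau_spec psin; set t := tau x n in tn z1 *.
rewrite (big_nat_widenl _ 0) //.
(* Positions below [t] contribute nothing, because an age never exceeds its time. *)
rewrite (big_cat_nat (n := t)) //= [X in X + _]big_nat_cond.
rewrite [X in X + _]big_pred0 ?add0r; last first.
  move=> i; apply/negP => /andP[/andP[_ it] /andP[/eqP ti psii]].
  by have [+ _ _] := tau_spec psii; rewrite ti leqNgt it.
rewrite -{1}[t]add0n big_addn; apply: congr_big_nat => // z zn.
  apply/andP/andP => [[tauz psiz]|[/eqP mz tm]].
    by have [_ + +] := (tau_eqP t psiz).1 tauz; rewrite addnK => ->.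
  have psiz : (psi x <= z + t)%N by apply/psi_le; exists z => //; lia.
  by split=> //; apply/tau_eqP => //; rewrite addnK; split=> //; lia.
have /andP[/andP[tauz psiz] _] := zn.
have [_ _] := (tau_eqP t psiz).1 tauz; rewrite addnK => tm.
by rewrite -addSn descends_sub.
Qed.

Lemma matches_descends n : (psi x <= n)%N ->
  matches x n =
  (\sum_(0 <= z < n - tau x n) ((m z == 0) && (tau x n <= m z.+1)))%N.
Proof.
move=> psin; have := @sum_matches nat n (fun=> 1%N) psin.
by rewrite [LHS]big_mkcond [RHS]big_mkcond.
Qed.

(** A run of length [l] passes through [l, ..., 1], of which [l - K] states exceed [K]. The term
    [m n - K] pays for the part of the current run not yet visited at time [n]. *)
Lemma zeros_before_above K n :
  (\sum_(0 <= z < n | m z == 0) (m z.+1 - K) <= above m K n + (m n - K))%N.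
Proof.
rewrite /above; elim: n => [|n IHn]; first by rewrite big_geq.
rewrite big_mkcond !big_nat_recr //= -big_mkcond /=.
case: (posnP (m n)) => [mn0|mn]; first by rewrite mn0 /= in IHn *; lia.
by rewrite (md mn) /=; lia.
Qed.

(** States at most [K] are charged to the zero that ends their descent, at most [K.+1] per zero. The
    term [K - m n] covers the descent still under way at time [n]. *)
Lemma below_zeros K n : (n <= above m K n + K.+1 * zeros m n + (K - m n))%N.
Proof.
rewrite /above /zeros; elim: n => [|n IHn]; first by rewrite !big_geq.
rewrite !big_nat_recr //=.
case: (posnP (m n)) => [mn0|mn]; first by rewrite mn0 /= in IHn *; nia.
by rewrite (md mn) /=; lia.
Qed.

(** If the age at [i + K] exceeds [K], then [m i > K]: otherwise the chain would reach zero at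
    [i + m i], inside the block of ones. Shifting by [K] therefore injects the times counted on the
    left into those counted by [above]. *)
Lemma count_tau_above K n :
  (\sum_(0 <= i < n) ((psi x <= i) && (K < tau x i)) <= above m K n)%N.
Proof.
have [nK|Kn] := leqP n K.
  rewrite big_nat_cond big1 // => i; rewrite andbT => /andP[_ iN].
  case: (boolP (psi x <= i)%N) => //= psii.
  by have [+ _ _] := tau_spec psii; case: ltnP => //; lia.
rewrite (big_cat_nat (n := K)) ?(ltnW Kn) //= big_nat_cond big1 ?add0n; last first.
  move=> i; rewrite andbT => /andP[_ iN].
  case: (boolP (psi x <= i)%N) => //= psii.
  by have [+ _ _] := tau_spec psii; case: ltnP => //; lia.
rewrite -{1}[K]add0n big_addn /above.
apply: (@leq_trans (\sum_(0 <= i < n - K) (K < m i))%N); last first.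
  by rewrite [leqRHS](big_cat_nat (n := (n - K)%N)) ?leq_subr //= leq_addr.
apply: leq_sum => i _; case: (boolP (psi x <= i + K)%N) => //= psii.
case: (ltnP K (tau x (i + K))) => // Ktau.
have [taui _ xi] := tau_spec psii.
rewrite lt0b ltnNge; apply/negP => miK.
have := xi (i + m i)%N ltac:(lia).
by rewrite /x /ones_of descends_sub // subnn.
Qed.

End Trajectory.

(** * Distances between distributions *)

Section WeightedDistance.
Context {R : realType}.
Implicit Types p q f : nat -> R.

Definition wsum f q : \bar R := (\sum_(0 <= k <oo) (f k * q k)%:E)%E.

(** The weight [k.+1] dominates both the indicator of [t <= k] and the truncated difference [k - t],
    so one distance controls tail masses and residual means at every age. *)
Definition wdist q p : \bar R :=
  (\sum_(0 <= k <oo) (k.+1%:R * `|q k - p k|)%:E)%E.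

Lemma wdistC q p : wdist q p = wdist p q.
Proof. by apply: eq_eseriesr => k _; rewrite distrC. Qed.

Lemma nneseries_point (g : nat -> R) a : (forall k, 0 <= g k) ->
  (\sum_(0 <= k <oo) ((a == k)%:R * g k)%:E)%E = (g a)%:E.
Proof.
move=> g0; rewrite (@nneseriesD1 _ _ a) //; last first.
  by move=> k _; rewrite lee_fin mulr_ge0.
rewrite eqxx mul1r eseries0 ?adde0 // => k _ /=; rewrite eq_sym => /negbTE ->.
by rewrite mul0r.
Qed.

Lemma wsum_le f q p : (forall k, 0 <= f k <= k.+1%:R) ->
  (forall k, 0 <= q k) -> (forall k, 0 <= p k) ->
  (wsum f q <= wsum f p + wdist q p)%E.
Proof.
move=> f0 q0 p0.
have f0' k : 0 <= f k by case/andP: (f0 k).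
rewrite /wsum /wdist -nneseriesD; first last.
- by move=> k _ _; rewrite lee_fin mulr_ge0.
- by move=> k _ _; rewrite lee_fin mulr_ge0.
apply: lee_nneseries => k; first by rewrite lee_fin mulr_ge0.
move=> _; rewrite -EFinD lee_fin.
have /andP[fk0 fk1] := f0 k.
have h1 : q k <= p k + `|q k - p k| by rewrite -lerBlDl ler_norm.
apply: (le_trans (ler_wpM2l fk0 h1)); rewrite mulrDr lerD2l.
by rewrite ler_wpM2r.
Qed.

Lemma wsum_wdist f q p a b (d : R) : (forall k, 0 <= f k <= k.+1%:R) ->
  (forall k, 0 <= q k) -> (forall k, 0 <= p k) ->
  wsum f q = a%:E -> wsum f p = b%:E -> (wdist q p <= d%:E)%E ->
  `|a - b| <= d.
Proof.
move=> f0 q0 p0 ea eb dl.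
have := wsum_le f0 q0 p0; have := wsum_le f0 p0 q0.
rewrite (wdistC p q) ea eb => h1 h2.
have : (b%:E <= a%:E + d%:E)%E by apply: (le_trans h1); rewrite leeD2l.
have : (a%:E <= b%:E + d%:E)%E by apply: (le_trans h2); rewrite leeD2l.
by rewrite -!EFinD !lee_fin ler_norml; lra.
Qed.

Lemma nneseries_shift t (h : nat -> R) : (forall k, 0 <= h k) ->
  (\sum_(0 <= l <oo) (h (l + t)%N)%:E = \sum_(0 <= k <oo) ((t <= k)%:R * h k)%:E)%E.
Proof.
move=> h0; rewrite (nneseries_addn (f := fun k => (h k)%:E)); last first.
  by move=> i; rewrite lee_fin.
rewrite eseries_cond eseries_mkcond; apply: eq_eseriesr => k _.
by case: (leqP t k); rewrite ?mul1r ?mul0r.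
Qed.

(** Continuity at [p] of the residual law and residual mean at age [t]: numerators and denominators
    move by at most the distance [d], and the denominator stays above [B / 2] once [d <= B / 2]. *)
Lemma residual_continuous p t B b (e : R) : (forall k, 0 <= p k) ->
  wsum (fun k => (t <= k)%:R) p = B%:E -> 0 < B ->
  wsum (fun k => (k - t)%:R) p = b%:E -> 0 < e ->
  exists2 d : R, 0 < d & forall q A a, (forall k, 0 <= q k) ->
    wsum (fun k => (t <= k)%:R) q = A%:E ->
    wsum (fun k => (k - t)%:R) q = a%:E -> (wdist q p <= d%:E)%E ->
    [/\ 0 < A, `|a / A - b / B| <= e &
      (\sum_(0 <= l <oo) `|q (l + t)%N / A - p (l + t)%N / B|%:E <= e%:E)%E].
Proof.
move=> p0 eB B0 eb e0.
have b0 : 0 <= b.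
  by rewrite -lee_fin -eb nneseries_ge0 // => k _ _; rewrite lee_fin mulr_ge0.
(* A local Lipschitz constant for the ratio [a / A]: the factor [2 / B] bounds [A^-1], and
   [1 + b / B] collects the changes of numerator and denominator. *)
pose c := 2 / B * (1 + b / B).
have bB0 : 0 <= b / B by rewrite divr_ge0 // ltW.
have c0 : 0 < c by apply: mulr_gt0; [rewrite divr_gt0 ?ltr0n | clear -bB0; lra].
have d'0 : 0 < Num.min (B / 2) (e / c) by rewrite lt_min !divr_gt0 ?ltr0n.
exists (Num.min (B / 2) (e / c)) => //.
move=> q A a q0 eA ea dl.
set d := Num.min _ _ in dl.
have d0 : 0 < d := d'0.
have dB : d <= B / 2 by rewrite ge_min lexx.
have dc : d * c <= e by rewrite -ler_pdivlMr // ge_min lexx orbT.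
have AB : `|A - B| <= d.
  apply: (wsum_wdist _ _ _ eA eB dl) => // k.
  by rewrite ler0n ler_nat; case: (t <= k)%N.
have ab : `|a - b| <= d.
  apply: (wsum_wdist _ _ _ ea eb dl) => // k.
  by rewrite ler0n ler_nat; lia.
have A0 : B / 2 <= A by move: AB; rewrite ler_norml; clear -dB; lra.
have A00 : 0 < A by clear -A0 B0; lra.
have iA : A^-1 <= 2 / B by rewrite -[2 / B]invf_div lef_pV2 ?posrE // divr_gt0.
have iA0 : 0 <= A^-1 by rewrite invr_ge0 ltW.
have iB0 : 0 <= B^-1 by rewrite invr_ge0 ltW.
split => //.
  have -> : a / A - b / B = ((a - b) + (b / B) * (B - A)) / A.
    by field; rewrite !gt_eqF.
  rewrite normrM (ger0_norm iA0).
  apply: le_trans dc.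
  have -> : d * c = d * (1 + b / B) * (2 / B) by rewrite /c; ring.
  apply: ler_pM => //.
  apply: (le_trans (ler_normD _ _)); rewrite [leRHS]mulrDr mulr1 lerD //.
  by rewrite normrM (ger0_norm bB0) mulrC distrC ler_wpM2r.
(* The change of numerator is separated from the change of normalisation; summed over [l], each
   contributes at most [d / B]. *)
have bd l : (`|q (l + t)%N / A - p (l + t)%N / B|%:E <=
   (B^-1 * `|q (l + t)%N - p (l + t)%N|)%:E + ((d / A / B) * q (l + t)%N)%:E)%E.
  rewrite -EFinD lee_fin.
  have -> : q (l + t)%N / A - p (l + t)%N / B =
    B^-1 * (q (l + t)%N - p (l + t)%N) + ((B - A) / A / B) * q (l + t)%N.
    by field; rewrite !gt_eqF.
  apply: (le_trans (ler_normD _ _)); rewrite !normrM (ger0_norm iB0) lerD2l.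
  rewrite (ger0_norm iA0) (ger0_norm (q0 _)) ler_wpM2r // ler_wpM2r // ler_wpM2r //.
  by rewrite distrC.
apply: (le_trans (lee_nneseries _ (fun l _ => bd l))).
  by move=> l _ _; rewrite lee_fin.
rewrite nneseriesD; first last.
- by move=> l _ _; rewrite lee_fin mulr_ge0 // !divr_ge0 // ltW.
- by move=> l _ _; rewrite lee_fin mulr_ge0.
under eq_eseriesr do rewrite EFinM.
rewrite nneseriesZl; last by move=> l _; rewrite lee_fin.
under [X in (_ + X)%E]eq_eseriesr do rewrite EFinM.
rewrite nneseriesZl; last by move=> l _; rewrite lee_fin.
rewrite (nneseries_shift t q0).
rewrite -[X in (_ * _ + _ * X)%E]/(wsum _ q) eA.
rewrite (@nneseries_shift t (fun k => `|q k - p k|)) //.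
have h : (\sum_(0 <= k <oo) ((t <= k)%:R * `|q k - p k|)%:E <= d%:E)%E.
  apply: le_trans dl; apply: lee_nneseries => k _.
    by rewrite lee_fin mulr_ge0.
  by rewrite lee_fin ler_wpM2r // ler_nat; case: (t <= k)%N.
apply: (@le_trans _ _ (B^-1%:E * d%:E + (d / A / B)%:E * A%:E)%E).
  by rewrite leeD2r // lee_wpmul2l // lee_fin.
rewrite -!EFinM -EFinD lee_fin; apply: le_trans dc.
have -> : B^-1 * d + d / A / B * A = d * (2 / B) by field; rewrite !gt_eqF.
rewrite ler_wpM2l ?(ltW d0) // /c ler_peMr ?lerDl //.
by rewrite divr_ge0 ?ler0n // ltW.
Qed.

End WeightedDistance.

(** * Empirical run-length distributions *)

Definition emp {R : realType} (m : nat -> nat) (n k : nat) : R :=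
  (runs m k n)%:R / (zeros m n)%:R.

Section Empirical.
Context {R : realType}.
Variables (p : nat -> R) (m : nat -> nat).
Hypotheses (p_dist : prob_dist p) (p_mean : finite_mean p).
Hypothesis md : descends m.
Hypothesis above_rare :
  forall q, exists K, forall n, (q.+1 * above m K n <= n)%N.
Hypothesis runs_freq : forall k,
  ((runs m k n)%:R - p k * (zeros m n)%:R) / n%:R @[n --> \oo] --> (0 : R).

Let p0 k : 0 <= p k. Proof. by case: p_dist. Qed.

Lemma emp_ge0 n k : 0 <= emp m n k :> R.
Proof. by rewrite divr_ge0 ?ler0n. Qed.

Lemma wsum_emp (f : nat -> R) n : (forall k, 0 <= f k) ->
  wsum f (emp m n) =
  ((\sum_(0 <= z < n | m z == 0%N) f (m z.+1)) / (zeros m n)%:R)%:E.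
Proof.
move=> f0; rewrite /wsum.
pose g z k : R := (if m z == 0%N then f k else 0) / (zeros m n)%:R.
have g0 z k : 0 <= g z k by rewrite divr_ge0 ?ler0n //; case: ifP.
have e k : (f k * emp m n k)%:E =
    (\sum_(0 <= z < n) ((m z.+1 == k)%:R * g z k)%:E)%E.
  rewrite sumEFin; congr EFin; rewrite /emp /runs /g natr_sum mulrA mulr_sumr.
  rewrite mulr_suml; apply: eq_bigr => z _; rewrite mulrA; congr (_ * _).
  by case: (m z == 0%N); case: (m z.+1 == k); rewrite /= ?mulr1 ?mulr0 ?mul1r ?mul0r.
under eq_eseriesr do rewrite e.
rewrite nneseries_sum_nat; last first.
  by move=> i j; rewrite lee_fin mulr_ge0.
rewrite mulr_suml [in RHS]big_mkcond -sumEFin; apply: eq_bigr => z _.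
by rewrite nneseries_point // /g; case: ifP; rewrite ?mul0r.
Qed.

Lemma zeros_linear : exists2 C, (0 < C)%N & forall n,
  (C <= n)%N -> (n <= C * zeros m n)%N.
Proof.
(* At most half of the first [n] states exceed [K], and the others number at most [K.+1] per zero
   plus [K]. For [n] at least [4 * K.+1] this last [K] is below a quarter of [n], leaving a quarter
   to the zeros. *)
have [K hK] := above_rare 1; exists (4 * K.+1)%N => // n Cn.
have := hK n; have := below_zeros md K n; nia.
Qed.

Let mean_summable : (\sum_(0 <= k <oo) (k.+1%:R * p k)%:E < +oo)%E.
Proof.
under eq_eseriesr do rewrite -addn1 natrD mulrDl mul1r EFinD.
rewrite nneseriesD; first last.
- by move=> k _ _; rewrite lee_fin.
- by move=> k _ _; rewrite lee_fin mulr_ge0.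
by case: p_dist => _ ->; rewrite lte_add_pinfty // ltry.
Qed.

Lemma emp_cvg (k : nat) : emp m n k @[n --> \oo] --> p k.
Proof.
have [C C0 hC] := zeros_linear.
(* Since [n <= C * zeros m n], the factor [C] turns a bound relative to [n] into one relative to the
   number of zeros. *)
have h : (C%:R * (((runs m k n)%:R - p k * (zeros m n)%:R) / n%:R))
    @[n --> \oo] --> (0 : R).
  by rewrite -(mulr0 C%:R); apply: cvgM => //; exact: cvg_cst.
apply/cvgrPdist_le => e e0.
move/cvgr0Pnorm_le : h => /(_ e e0) h.
near=> n.
have Cn : (C <= n)%N by near: n; exists C.
have nz : (n <= C * zeros m n)%N by exact: hC.
have z0 : (0 < zeros m n)%N by nia.
have n0 : (0 < n)%N by lia.
apply: le_trans
  (_ : `|C%:R * (((runs m k n)%:R - p k * (zeros m n)%:R) / n%:R)| <= _);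
  last by near: n.
have -> : p k - emp m n k = - (((runs m k n)%:R - p k * (zeros m n)%:R) / (zeros m n)%:R).
  by rewrite /emp; field; rewrite pnatr_eq0 -lt0n.
rewrite normrN mulrCA !normrM ler_wpM2l //.
rewrite normfV !ger0_norm ?ler0n // ?divr_ge0 ?ler0n //.
rewrite ler_pdivlMr ?ltr0n // mulrC ler_pdivrMr ?ltr0n //.
by rewrite -natrM ler_nat.
Unshelve. all: by end_near. Qed.

(** For [k > 2K] the weight [k.+1] is at most [2 * (k - K)], and the total excess over [K] is
    bounded by [above]. At a zero no run is in progress, so the correction term of
    [zeros_before_above] vanishes. *)
Lemma emp_tail K N n : m n = 0%N -> (K.*2 < N)%N ->
  (\sum_(N <= k <oo) (k.+1%:R * emp m n k)%:E <=
   (2 * (above m K n)%:R / (zeros m n)%:R : R)%:E)%E.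
Proof.
move=> mn KN.
apply: (@le_trans _ _ (wsum (fun k => 2 * (k - K)%:R) (emp m n))).
  rewrite /wsum [leRHS](nneseries_split 0 N); last first.
    by move=> k _; rewrite lee_fin mulr_ge0 ?emp_ge0// mulr_ge0.
  rewrite add0n -[leLHS]add0e; apply: leeD.
    by apply: sume_ge0 => k _; rewrite lee_fin mulr_ge0 ?emp_ge0// mulr_ge0.
  rewrite [leLHS]eseries_cond [leRHS]eseries_cond; apply: lee_nneseries.
    by move=> k _ _; rewrite lee_fin mulr_ge0 ?emp_ge0.
  move=> k /= Nk; rewrite lee_fin ler_wpM2r ?emp_ge0// -natrM ler_nat; lia.
rewrite wsum_emp; last by move=> k; rewrite mulr_ge0.
rewrite lee_fin ler_wpM2r ?invr_ge0 ?ler0n // -mulr_sumr ler_wpM2l //.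
rewrite -natr_sum ler_nat; have := zeros_before_above md K n.
by rewrite mn sub0n addn0.
Qed.

(** The series is cut at a fixed level: the finitely many first terms converge, the tail of [p] is
    small by the finite mean, and the empirical tail is small by [emp_tail]. Each part receives
    [d / 3]. *)
Lemma wdist_emp (d : R) : 0 < d -> exists N, forall n, (N <= n)%N ->
  m n = 0%N -> (0 < zeros m n)%N /\ (wdist (emp m n) p <= d%:E)%E.
Proof.
move=> d0; have [C C0 hC] := zeros_linear.
have d3 : 0 < d / 3 by rewrite divr_gt0.
(* Chosen so that the empirical tail, at most [2 * C / q.+1], is below [d / 3]. *)
pose q := Num.truncn (2 * C%:R / (d / 3)).
have [K hK] := above_rare q.
have tailp := nneseries_tail_cvg mean_summable
  (fun k _ => ltac:(by rewrite lee_fin mulr_ge0)).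
have [L _ hL] : \forall N \near \oo, (\sum_(N <= k <oo) (k.+1%:R * p k)%:E < (d / 3)%:E)%E.
  have /fine_cvgP[fin /cvgr0Pnorm_lt /(_ _ d3) lim] := tailp.
  near=> N.
  have f : (\sum_(N <= k <oo) (k.+1%:R * p k)%:E)%E \is a fin_num by near: N.
  rewrite -(fineK f) lte_fin; apply: le_lt_trans (ler_norm _) _.
  by near: N.
pose N := maxn L K.*2.+1.
have headc : (\sum_(0 <= k < N) (k.+1%:R * `|emp m n k - p k|) : R) @[n --> \oo] --> (0 : R).
  have z : \sum_(0 <= k < N) (k.+1%:R * `|p k - p k|) = 0 :> R.
    by rewrite big1 // => k _; rewrite subrr normr0 mulr0.
  rewrite -[X in _ --> X]z; apply: cvg_big => [|k _]; first exact: add_continuous.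
  apply: cvgM; first exact: cvg_cst.
  by apply: cvg_norm; apply: cvgB; [exact: emp_cvg|exact: cvg_cst].
move/cvgr0Pnorm_le : headc => /(_ _ d3)[n0 _ hn0].
exists (maxn C n0) => n Nn mn.
have nz := hC n ltac:(lia).
have z0 : (0 < zeros m n)%N by nia.
split=> //; rewrite /wdist (nneseries_split 0 N); last first.
  by move=> k _; rewrite lee_fin mulr_ge0.
rewrite add0n.
have -> : d = d / 3 + (d / 3 + d / 3) by field.
rewrite EFinD; apply: leeD.
  rewrite sumEFin lee_fin; apply: le_trans (ler_norm _) _.
  by apply: hn0 => /=; lia.
apply: (@le_trans _ _ (\sum_(N <= k <oo) ((k.+1%:R * p k)%:E + (k.+1%:R * emp m n k)%:E))%E).
  apply: lee_nneseries => [k _ _|k _]; first by rewrite lee_fin mulr_ge0.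
  rewrite -EFinD lee_fin -mulrDr ler_wpM2l // (le_trans (ler_normB _ _)) //.
  by rewrite !ger0_norm ?emp_ge0 // addrC.
rewrite nneseriesD; first last.
- by move=> k _ _; rewrite lee_fin mulr_ge0 ?emp_ge0.
- by move=> k _ _; rewrite lee_fin mulr_ge0.
rewrite EFinD; apply: leeD; first by apply/ltW/hL; rewrite /= /N leq_maxl.
apply: (le_trans (emp_tail mn (_ : K.*2 < N)%N)); first by rewrite /N leq_maxr.
rewrite lee_fin ler_pdivrMr ?ltr0n //.
have h : 2 * C%:R <= q.+1%:R * (d / 3) :> R.
  rewrite -ler_pdivrMr //; exact/ltW/truncnS_gt.
have hk : (q.+1 * above m K n <= C * zeros m n)%N by apply: leq_trans nz.
have hk' : q.+1%:R * (above m K n)%:R <= C%:R * (zeros m n)%:R :> R.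
  by rewrite -!natrM ler_nat.
rewrite -(@ler_pM2l _ q.+1%:R) ?ltr0n //.
apply: (@le_trans _ _ (2 * (C%:R * (zeros m n)%:R))).
  by rewrite mulrCA ler_pM2l.
by rewrite mulrA [leRHS]mulrA ler_pM2r ?ltr0n.
Unshelve. all: by end_near. Qed.

End Empirical.

(** * Sets of density one *)

(* [lev n] is the largest level whose exceptional set has density at most
   [1 / (lev n + 1)] from [n] on; [D] avoids the exceptional set of level
   [lev n] at [n]. *)
Lemma density_one_diagonal (R : realType) (bad : nat -> nat -> bool) :
  (forall k l i, (k <= l)%N -> bad k i -> bad l i) ->
  (forall k j, exists N, forall n, (N <= n)%N ->
     (j.+1 * \sum_(0 <= i < n.+1) bad k i <= n.+1)%N) ->
  exists D : set nat,
    (#|[pred i : 'I_n.+1 | (i : nat) \in D]|%:R / n.+1%:R : R)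
      @[n --> \oo] --> (1 : R) /\
    forall k, exists N, forall n, (N <= n)%N -> D n -> ~~ bad k n.
Proof.
move=> bad_mono bad_rare.
pose good k n := `[< forall n', (n <= n')%N ->
  (k.+1 * \sum_(0 <= i < n'.+1) bad k i <= n'.+1)%N >].
(* The cap [k < n.+1] keeps the maximum finite. Level 0 is always good, so the maximum is itself a
   good level. *)
pose lev n := \max_(k < n.+1 | good k n) k.
have good0 n : good 0%N n.
  apply/asboolP => n' _; rewrite mul1n.
  apply: (@leq_trans (\sum_(0 <= i < n'.+1) 1)%N).
    by apply: leq_sum => i _; case: (bad _ _).
  by rewrite sum_nat_const_nat muln1 subn0.
have good_lev n : good (lev n) n.
  rewrite /lev; elim/big_ind : _ => [|a b ga gb|k //]; first exact: good0.
  by rewrite /maxn; case: ifP.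
have lev_ge k n : (k <= n)%N -> good k n -> (k <= lev n)%N.
  move=> kn gk; rewrite /lev.
  exact: (@leq_bigmax_cond _ (fun k : 'I_n.+1 => good k n)
    (fun k => k : nat) (Ordinal (kn : k < n.+1)%N)).
have lev_mono i n : (i <= n)%N -> (lev i <= lev n)%N.
  move=> ij; apply: lev_ge.
    apply: leq_trans ij; apply/bigmax_leqP => k _; by rewrite -ltnS ltn_ord.
  have /asboolP g := good_lev i; apply/asboolP => n' nn'.
  by apply: g; apply: leq_trans nn'.
have lev_infty k : exists N, forall n, (N <= n)%N -> (k <= lev n)%N.
  have [N hN] := bad_rare k k; exists (maxn k N) => n kn.
  apply: lev_ge; first lia.
  by apply/asboolP => n' nn'; apply: hN; lia.
exists [set n | ~~ bad (lev n) n]; split; last first.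
  move=> k; have [N hN] := lev_infty k; exists N => n Nn /=; apply: contra.
  exact/bad_mono/hN.
apply/cvgrPdist_le => e e0.
have [N hN] := lev_infty (Num.truncn e^-1).
exists N => // n /= Nn.
have cardE : (#|[pred i : 'I_n.+1 | (i : nat) \in [set n | ~~ bad (lev n) n]]| +
    \sum_(0 <= i < n.+1) bad (lev i) i = n.+1)%N.
  rewrite -sum1_card big_mkord big_mkcond -big_split /=.
  rewrite -[RHS]card_ord -sum1_card; apply: eq_bigr => i _.
  have memD : ((i : nat) \in [set n | ~~ bad (lev n) n]) = ~~ bad (lev i) i.
    by apply/idP/idP; rewrite inE.
  by rewrite inE memD; case: (bad _ _).
set b := (\sum_(0 <= i < n.+1) bad (lev i) i)%N in cardE.
(* Levels increase with time and exceptional sets with the level, so every exception up to [n] is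
   already one for the level [lev n]. *)
have bn : ((lev n).+1 * b <= n.+1)%N.
  have /asboolP g := good_lev n.
  apply: leq_trans (g n (leqnn n)); rewrite leq_mul2l /=.
  rewrite /b big_nat_cond [leqRHS]big_nat_cond; apply: leq_sum => i /andP[/andP[_ iin] _].
  case: (boolP (bad (lev i) i)) => // /(bad_mono _ (lev n)) -> //.
  exact: lev_mono.
have -> : #|[pred i : 'I_n.+1 | (i : nat) \in [set n | ~~ bad (lev n) n]]|%:R
    = n.+1%:R - b%:R :> R.
  by rewrite -[in n.+1%:R]cardE natrD addrK.
have -> : 1 - (n.+1%:R - b%:R) / n.+1%:R = b%:R / n.+1%:R :> R by field.
rewrite ger0_norm ?divr_ge0 ?ler0n // ler_pdivrMr ?ltr0n //.
have le : e^-1 <= (lev n).+1%:R :> R.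
  apply/ltW/(lt_le_trans (truncnS_gt _)); rewrite ler_nat ltnS; exact: hN.
rewrite -ler_pdivrMl // mulrC.
apply: (@le_trans _ _ (b%:R * (lev n).+1%:R)); first by rewrite ler_wpM2l.
by rewrite -natrM ler_nat mulnC.
Qed.

Lemma cvge0_within (R : realType) (D : set nat) (f : nat -> \bar R) :
  (forall n, (0 <= f n)%E) ->
  (forall k, exists N, forall n, (N <= n)%N -> D n -> (f n <= (k.+1%:R^-1)%:E)%E) ->
  f n @[n --> within D \oo] --> 0%E.
Proof.
move=> f0 fD; apply/fine_cvgP; split.
  have [N hN] := fD 0%N; exists N => // n /= Nn Dn.
  by rewrite ge0_fin_numE //; apply: le_lt_trans (hN _ Nn Dn) (ltry _).
apply/cvgr0Pnorm_le => e e0.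
have [N hN] := fD (Num.truncn e^-1); exists N => // n /= Nn Dn.
have fn := hN _ Nn Dn.
have ffin : f n \is a fin_num by rewrite ge0_fin_numE //; apply: le_lt_trans fn (ltry _).
rewrite ger0_norm ?fine_ge0 // -lee_fin fineK //; apply: (le_trans fn).
rewrite lee_fin -[leRHS]invrK lef_pV2 ?posrE ?invr_gt0 ?ltr0n //.
exact/ltW/truncnS_gt.
Qed.

(** * Convergence of the estimators along a trajectory *)

Section Estimators.
Context {R : realType}.
Variables (p : nat -> R) (m : nat -> nat).
Hypotheses (p_dist : prob_dist p) (p_mean : finite_mean p).
Hypothesis md : descends m.
Hypothesis above_rare :
  forall q, exists K, forall n, (q.+1 * above m K n <= n)%N.
Hypothesis runs_freq : forall k,
  ((runs m k n)%:R - p k * (zeros m n)%:R) / n%:R @[n --> \oo] --> (0 : R).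

Let x := ones_of m.
Let p0 k : 0 <= p k. Proof. by case: p_dist. Qed.

Lemma wsum_tail t : wsum (fun k => (t <= k)%:R) p = (tail_prob p t)%:E.
Proof.
rewrite /tail_prob -(nneseries_addn (f := fun k => (p k)%:E)) //.
rewrite (nneseries_shift t p0) fineK // ge0_fin_numE; last first.
  by apply: nneseries_ge0 => k _ _; rewrite lee_fin mulr_ge0.
apply: le_lt_trans (ltry 1); case: p_dist => _ <-; apply: lee_nneseries => k _.
  by rewrite lee_fin mulr_ge0.
by rewrite lee_fin ler_piMl //; case: (t <= k)%N.
Qed.

Lemma wsum_residual_fin t : wsum (fun k => (k - t)%:R) p \is a fin_num.
Proof.
rewrite ge0_fin_numE; last first.
  by apply: nneseries_ge0 => k _ _; rewrite lee_fin mulr_ge0.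
apply: le_lt_trans p_mean; apply: lee_nneseries => k _.
  by rewrite lee_fin mulr_ge0.
by rewrite lee_fin ler_wpM2r // ler_nat leq_subr.
Qed.

(** Truncated subtraction kills the runs shorter than [t], so the numerator is the sum of
    [k * p (k + t)]: this is the closed formula for the conditional expectation at age [t]. *)
Definition residual_mean t : R :=
  fine (wsum (fun k => (k - t)%:R) p) / tail_prob p t.

Lemma est_meanE n : (psi x <= n)%N -> (0 < matches x n)%N ->
  est_mean x n = ((\sum_(0 <= z < n - tau x n | m z == 0%N)
     (m z.+1 - tau x n)%:R) / (matches x n)%:R)%:E :> \bar R.
Proof.
move=> psin mn; rewrite /est_mean (gtn_eqF mn) EFinM; congr (_ * _)%E.
under eq_bigr do rewrite (sigma_descends md).
rewrite (sum_matches md (fun j => j%:R%:E) psin) sumEFin; congr EFin.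
rewrite big_mkcondr /=; apply: eq_bigr => z _.
by case: leqP => // /ltnW; rewrite -subn_eq0 => /eqP ->.
Qed.

Lemma est_probE n l : (psi x <= n)%N -> (0 < matches x n)%N ->
  est_prob (R := R) x n l =
  (runs m (l + tau x n) (n - tau x n))%:R / (matches x n)%:R.
Proof.
move=> psin mn; rewrite /est_prob (gtn_eqF mn); congr (_%:R / _).
under eq_bigr do rewrite (sigma_descends md) eqe eqr_nat.
have := @sum_matches m md nat n (fun j => j == l) psin.
rewrite big_mkcond /= => e.
apply: etrans (etrans e _).
  by apply: eq_bigr => i _; case: eqP.
rewrite /runs big_mkcond /=; apply: eq_bigr => z _.
by case: (m z == 0%N) => //=; rewrite -/x; case: leqP => h; lia.
Qed.

(** Both estimators are ratios of sums over [emp m (n - t)] in which the number of zeros cancels. As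
    [n - t] is a zero, [wdist_emp] applies there, and continuity of the residual quantities
    concludes. *)
Lemma estimators_fixed_tau (theta : nat -> \bar R) t (e : R) : 0 < e ->
  (forall n, (psi x <= n)%N -> 0 < tail_prob p (tau x n) /\
     theta n = (residual_mean (tau x n))%:E) ->
  exists N, forall n, (N <= n)%N -> (psi x <= n)%N -> tau x n = t ->
    (`|est_mean x n - theta n| <= e%:E)%E /\
    (\sum_(0 <= l <oo) `|est_prob (R := R) x n l -
       p (l + tau x n)%N / tail_prob p (tau x n)|%:E <= e%:E)%E.
Proof.
move=> e0 hth.
(* An age that never occurs needs no bound; one that occurs has positive tail mass, which the
   continuity lemma requires. *)
have [[n1 psin1 tn1]|none] := pselect (exists2 n, (psi x <= n)%N & tau x n = t); last first.
  by exists 0%N => n _ psin tn; exfalso; apply: none; exists n.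
have [B0 _] := hth _ psin1; rewrite tn1 in B0.
have [d d0 hd] := residual_continuous p0 (wsum_tail t) B0
  (esym (fineK (wsum_residual_fin t))) e0.
have [N hN] := wdist_emp p_dist p_mean md above_rare runs_freq d0.
exists (N + t)%N => n Nn psin tn.
have [ltn mz _] := tau_spec md psin; rewrite tn in ltn mz.
have [z0 wd] := hN (n - t)%N ltac:(lia) mz.
have matchesR : (matches x n)%:R =
    \sum_(0 <= z < n - t | m z == 0%N) (t <= m z.+1)%:R :> R.
  rewrite (matches_descends md psin) tn natr_sum [RHS]big_mkcond /=.
  by apply: eq_bigr => z _; case: (m z == 0%N).
have [A0 hmean hprob] := hd _ _ _ (@emp_ge0 R m (n - t)%N)
  (wsum_emp _ _ (fun k => ler0n R (t <= k)%N))
  (wsum_emp _ _ (fun k => ler0n R (k - t)%N)) wd.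
rewrite -matchesR in A0 hmean hprob.
have mn0 : (0 < matches x n)%N.
  rewrite lt0n; apply/negP => /eqP h; by rewrite h mul0r ltxx in A0.
have [znz mnz] : (zeros m (n - t))%:R != 0 :> R /\ (matches x n)%:R != 0 :> R.
  by rewrite !pnatr_eq0 -!lt0n.
have [_ ->] := hth _ psin.
rewrite est_meanE // tn; split.
  rewrite -EFinB lee_fin; apply: le_trans hmean; rewrite /residual_mean.
  by rewrite invf_div mulrA divfK.
apply: le_trans hprob; rewrite le_eqVlt; apply/orP; left; apply/eqP.
apply: eq_eseriesr => l _; rewrite est_probE // tn /emp.
by rewrite invf_div mulrA divfK.
Qed.

Lemma estimators_converge (theta : nat -> \bar R) :
  (forall n, (psi x <= n)%N -> 0 < tail_prob p (tau x n) /\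
     theta n = (residual_mean (tau x n))%:E) ->
  exists D : set nat,
    [/\ (#|[pred i : 'I_n.+1 | (i : nat) \in D]|%:R / n.+1%:R : R)
          @[n --> \oo] --> (1 : R),
        `|est_mean x n - theta n|%E @[n --> within D \oo] --> 0%E &
        (\sum_(0 <= l <oo) (`|est_prob (R := R) x n l -
              p (l + tau x n)%N / tail_prob p (tau x n)|)%:E)%E
          @[n --> within D \oo] --> 0%E].
Proof.
move=> hth.
pose e1 n : \bar R := `|est_mean x n - theta n|%E.
pose e2 n : \bar R := (\sum_(0 <= l <oo) (`|est_prob (R := R) x n l -
              p (l + tau x n)%N / tail_prob p (tau x n)|)%:E)%E.
pose bad k n := ~~ ((e1 n <= (k.+1%:R^-1)%:E)%E && (e2 n <= (k.+1%:R^-1)%:E)%E).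
have [||D [Dd hD]] := @density_one_diagonal R bad.
- move=> k l i kl; apply: contra => /andP[h1 h2].
  have kl' : ((l.+1%:R^-1 : R)%:E <= (k.+1%:R^-1)%:E)%E.
    by rewrite lee_fin lef_pV2 ?posrE ?ltr0n // ler_nat.
  by rewrite (le_trans h1 kl') (le_trans h2 kl').
(* A bad time is either below [N0], the largest threshold over ages up to [K], or has age above [K].
   The doubled constants give each kind half of the allowed proportion [1 / j.+1]. *)
- move=> k j; have [K hK] := above_rare (2 * j).+1.
  have k0 : 0 < k.+1%:R^-1 :> R by rewrite invr_gt0 ltr0n.
  have [Nt hNt] := choice (fun t => estimators_fixed_tau t k0 hth).
  pose N0 := maxn (psi x) (\max_(t < K.+1) Nt t).
  exists (2 * j.+1 * N0)%N => n Nn.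
  have cnt : (\sum_(0 <= i < n.+1) bad k i <= N0 + above m K n.+1)%N.
    apply: leq_trans (leq_add (leqnn N0) (count_tau_above md K n.+1)).
    apply: (@leq_trans (\sum_(0 <= i < n.+1) ((i < N0) + ((psi x <= i) && (K < tau x i))))%N).
      apply: leq_sum => i _; case: (ltnP i N0) => [_|iN] /=.
        by case: (bad _ _).
      have psii : (psi x <= i)%N by apply: leq_trans iN; rewrite leq_maxl.
      rewrite psii /=; case: (ltnP K (tau x i)) => [_|tK]; first by case: (bad _ _).
      have Ni : (Nt (tau x i) <= i)%N.
        apply: leq_trans iN; apply: leq_trans (leq_maxr _ _).
        exact: (@leq_bigmax _ (fun t : 'I_K.+1 => Nt t) (Ordinal (tK : tau x i < K.+1)%N)).
      have [h1 h2] := hNt _ _ Ni psii erefl.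
      by rewrite /bad /e1 /e2 h1 h2.
    rewrite big_split /= leq_add2r.
    have : (\sum_(0 <= i < n.+1) (i < N0) <= N0)%N; last by [].
    rewrite -[leqRHS]card_ord -sum1_card -(big_mkord xpredT (fun=> 1%N)).
    rewrite (_ : \sum_(0 <= i < n.+1) _ = \sum_(0 <= i < n.+1 | (i < N0)) 1)%N; last first.
      by rewrite [RHS]big_mkcond; apply: eq_bigr => i _; case: ltnP.
    have [nN|Nn'] := leqP n.+1 N0.
      rewrite (big_nat_widen _ _ _ _ _ nN) big_mkcond [leqRHS]big_mkcond.
      by apply: leq_sum => i _; case: ifP.
    by rewrite [leqRHS](big_nat_widen _ _ n.+1) // ltnW.
  by have := hK n.+1; nia.
exists D; split=> //; apply: cvge0_within => [n|k].
- exact: abse_ge0.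
- have [N hN] := hD k; exists N => n Nn Dn.
  by have := hN n Nn Dn; rewrite negbK => /andP[].
- by apply: nneseries_ge0 => l _ _; rewrite lee_fin.
- have [N hN] := hD k; exists N => n Nn Dn.
  by have := hN n Nn Dn; rewrite negbK => /andP[].
Qed.

End Estimators.

(** * Maps with countably many values *)

Section CountableValued.
Context {d : measure_display} {T : measurableType d} {R : realType}.
Variable P : probability T R.

Lemma ae_off_negligible (N : set T) (Q : T -> Prop) :
  P.-negligible N -> (forall w, ~ N w -> Q w) -> {ae P, forall w, Q w}.
Proof.
move=> N0 NQ; apply: (negligibleS _ N0) => w /= nQ.
by apply: contrapT => /NQ.
Qed.

(** Used for finite paths, with values in types such as [seq nat]: no sigma-algebra has to be fixed
    on the codomain, and countability makes every preimage measurable. *)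
Definition fiber_measurable (C : countType) (g : T -> C) :=
  forall c, measurable (g @^-1` [set c]).

Let code (C : countType) (g : T -> C) i := g @^-1` [set c | pickle c = i].

Let measurable_code (C : countType) (g : T -> C) (A : set C) i :
  fiber_measurable g -> measurable (g @^-1` A `&` code g i).
Proof.
move=> mg; have [[c [Ac ci]]|none] := pselect (exists c, A c /\ pickle c = i).
  rewrite (_ : _ `&` _ = g @^-1` [set c]); first exact: mg.
  apply/seteqP; split=> w /=; last by move=> gc; rewrite /code /= gc.
  by move=> [_ gi]; apply: (pcan_inj (@pickleK C)); rewrite ci; exact: gi.
rewrite (_ : _ `&` _ = set0) //; apply/seteqP; split=> w //= [Aw gi].
by apply: none; exists (g w).
Qed.

Let bigcup_code (C : countType) (g : T -> C) (S : set T) :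
  S = \bigcup_i (S `&` code g i).
Proof.
by apply/seteqP; split=> w; [exists (pickle (g w))|case=> ? _ []].
Qed.

Lemma measurable_fibers (C : countType) (g : T -> C) (A : set C) :
  fiber_measurable g -> measurable (g @^-1` A).
Proof.
move=> mg; rewrite (bigcup_code g (g @^-1` A)).
by apply: bigcup_measurable => i _; exact: measurable_code.
Qed.

Lemma fiber_measurable_comp (C C' : countType) (g : T -> C) (h : C -> C') :
  fiber_measurable g -> fiber_measurable (h \o g).
Proof.
by move=> mg c; rewrite comp_preimage; exact: measurable_fibers.
Qed.

Lemma fiber_measurable_pair (C C' : countType) (g : T -> C) (h : T -> C') :
  fiber_measurable g -> fiber_measurable h ->
  fiber_measurable (fun w => (g w, h w)).
Proof.
move=> mg mh [c c'].
rewrite (_ : _ @^-1` _ = g @^-1` [set c] `&` h @^-1` [set c']).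
  exact: measurableI.
by apply/seteqP; split=> w /= [-> ->].
Qed.

Lemma fiber_measurable_path (C : countType) (g : nat -> T -> C) n :
  (forall i, fiber_measurable (g i)) ->
  fiber_measurable (fun w => mkseq (g^~ w) n).
Proof.
move=> mg; elim: n => [|n IHn] c.
  have [->|c0] := eqVneq c [::].
    by rewrite (_ : _ @^-1` _ = setT) //; apply/seteqP; split.
  by rewrite (_ : _ @^-1` _ = set0) //; apply/seteqP; split=> w //= /esym/eqP;
    rewrite (negbTE c0).
have -> : (fun w => mkseq (g^~ w) n.+1) =
    (fun sk : seq C * C => rcons sk.1 sk.2) \o
    (fun w => (mkseq (g^~ w) n, g n w)).
  by apply/funext => w /=; exact: mkseqS.
by apply: fiber_measurable_comp; exact: fiber_measurable_pair.
Qed.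

Lemma measure_fibers (C : countType) (g : T -> C) (S : set T) :
  fiber_measurable g -> measurable S ->
  P S = (\sum_(0 <= i <oo) P (S `&` code g i))%E.
Proof.
move=> mg mS.
have mi i : measurable (S `&` code g i).
  by apply: measurableI => //; exact: measurable_fibers.
rewrite {1}(bigcup_code g S) measure_semi_bigcup //; first last.
- exact: bigcup_measurable.
- apply/trivIsetP => i j _ _ /eqP ij; apply/seteqP; split=> w //=.
  by move=> [[_ gi] [_ gj]]; apply: ij; rewrite -gi -gj.
Qed.

(** A constant ratio on each fiber is summed over the countable partition into fibers. This lifts
    identities for single paths to events. *)
Lemma eq_measure_fibers (C : countType) (g g' : T -> C) (S S' : set T)
    (A : set C) (a : R) : fiber_measurable g -> fiber_measurable g' ->
  measurable S -> measurable S' -> 0 <= a ->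
  (forall c, A c -> P (S `&` g @^-1` [set c]) =
     (P (S' `&` g' @^-1` [set c]) * a%:E)%E) ->
  P (S `&` g @^-1` A) = (P (S' `&` g' @^-1` A) * a%:E)%E.
Proof.
move=> mg mg' mS mS' a0 e.
rewrite (measure_fibers mg (measurableI _ _ mS (measurable_fibers A mg))).
rewrite (measure_fibers mg' (measurableI _ _ mS' (measurable_fibers A mg'))).
rewrite muleC -nneseriesZl //; apply: eq_eseriesr => i _; rewrite muleC.
have [[c [Ac ci]]|none] := pselect (exists c, A c /\ pickle c = i).
  have cE (h : T -> C) (U : set T) :
      (U `&` h @^-1` A) `&` code h i = U `&` h @^-1` [set c].
    apply/seteqP; split=> w /=; last by move=> [Uw gc]; rewrite /code /= gc.
    by move=> [[Uw _] gi]; split=> //; apply: (pcan_inj (@pickleK C)); rewrite ci; exact: gi.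
  by rewrite !cE e.
have c0 (h : T -> C) (U : set T) : (U `&` h @^-1` A) `&` code h i = set0.
  by apply/seteqP; split=> w //= [[_ Aw] gi]; apply: none; exists (h w).
by rewrite !c0 measure0 mul0e.
Qed.

Lemma ae_fiber_neq0 (C : countType) (g : T -> C) : fiber_measurable g ->
  {ae P, forall w, P (g @^-1` [set g w]) != 0%E}.
Proof.
move=> mg; pose N i := \bigcup_(c in [set c : C | pickle c = i /\
  P (g @^-1` [set c]) = 0%E]) (g @^-1` [set c]).
apply: (@ae_off_negligible (\bigcup_i N i)); last first.
  move=> w Nw; apply/eqP => w0; apply: Nw.
  by exists (pickle (g w)) => //; exists (g w).
apply: negligible_bigcup => i; rewrite /N.
have [[c [ci c0]]|none] := pselect (exists c, pickle c = i /\ P (g @^-1` [set c]) = 0%E).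
  exists (g @^-1` [set c]); split=> // w [c' [c'i _] /= gc'].
  by rewrite gc'; apply: (pcan_inj (@pickleK C)); rewrite ci c'i.
exists set0; split=> // w [c' cc _]; apply: none; by exists c'.
Qed.

Lemma integral_nat_valued (g : T -> nat) (D : set T) (h : nat -> R) :
  fiber_measurable g -> measurable D -> (forall k, 0 <= h k) ->
  (\int[P]_(v in D) (h (g v))%:E =
   \sum_(0 <= k <oo) (h k)%:E * P (D `&` g @^-1` [set k]))%E.
Proof.
move=> mg mD h0.
have hE v : ((h (g v))%:E =
    \sum_(0 <= k <oo) (h k)%:E * (\1_(g @^-1` [set k]) v)%:E)%E.
  rewrite (@nneseriesD1 _ _ (g v)) //; last first.
    by move=> k _; rewrite mule_ge0 ?lee_fin.
  rewrite indicE mem_set // mule1 eseries0 ?adde0 // => k _ /= /eqP kg.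
  by rewrite indicE memNset ?mule0 // => /= gk; apply: kg.
under eq_integral do rewrite hE.
rewrite integral_nneseries //; first last.
- by move=> k v _; rewrite mule_ge0 ?lee_fin.
- move=> k; apply: measurable_funeM; apply/measurable_EFinP.
  by apply: measurable_indic; exact: mg.
apply: eq_eseriesr => k _.
rewrite ge0_integralZl_EFin //; first by rewrite integral_indic // setIC.
by apply/measurable_EFinP; apply: measurable_indic; exact: mg.
Qed.

End CountableValued.

(** * Bounded orthogonal sequences *)

Section Orthogonal.
Context {d : measure_display} {T : measurableType d} {R : realType}.
Variable P : probability T R.

Definition bmeasurable (f : T -> R) :=
  measurable_fun setT f /\ exists C, forall w, `|f w| <= C.

Lemma bmeasurable_integrable f : bmeasurable f -> P.-integrable setT (EFin \o f).
Proof.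
move=> [mf [C fC]]; apply: measurable_bounded_integrable => //.
  by apply: le_lt_trans (probability_le1 _ _) (ltry _).
exists C; split; first exact: num_real.
by move=> y Cy w _; exact: le_trans (fC w) (ltW Cy).
Qed.

Lemma bmeasurableD f g : bmeasurable f -> bmeasurable g ->
  bmeasurable (fun w => f w + g w).
Proof.
move=> [mf [C fC]] [mg [D gD]]; split; first exact: measurable_funD.
by exists (C + D) => w; rewrite (le_trans (ler_normD _ _)) // lerD.
Qed.

Lemma bmeasurableM f g : bmeasurable f -> bmeasurable g ->
  bmeasurable (fun w => f w * g w).
Proof.
move=> [mf [C fC]] [mg [D gD]]; split; first exact: measurable_funM.
by exists (C * D) => w; rewrite normrM ler_pM.
Qed.

Lemma bmeasurable_cst (c : R) : bmeasurable (fun=> c).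
Proof. by split; [exact: measurable_cst|exists `|c|]. Qed.

Lemma bmeasurable_indic A : measurable A -> bmeasurable (\1_A).
Proof.
move=> mA; split; first exact: measurable_indic.
by exists 1 => w; rewrite indicE; case: (_ \in _); rewrite ?normr1 ?normr0.
Qed.

Lemma bmeasurable_sum (f : nat -> T -> R) n : (forall i, bmeasurable (f i)) ->
  bmeasurable (fun w => \sum_(0 <= i < n) f i w).
Proof.
move=> bf; elim: n => [|n IHn].
  by under eq_fun do rewrite big_geq //; exact: bmeasurable_cst.
under eq_fun do rewrite big_nat_recr //=.
exact: bmeasurableD.
Qed.

Lemma Rintegral_bD f g : bmeasurable f -> bmeasurable g ->
  \int[P]_w (f w + g w) = \int[P]_w f w + \int[P]_w g w.
Proof. by move=> bf bg; rewrite RintegralD //; exact: bmeasurable_integrable. Qed.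

Lemma Rintegral_bZ c f : bmeasurable f ->
  \int[P]_w (c * f w) = c * \int[P]_w f w.
Proof. by move=> bf; rewrite RintegralZl //; exact: bmeasurable_integrable. Qed.

Lemma Rintegral_bsum (f : nat -> T -> R) n : (forall i, bmeasurable (f i)) ->
  \int[P]_w (\sum_(0 <= i < n) f i w) = \sum_(0 <= i < n) \int[P]_w f i w.
Proof.
move=> bf; elim: n => [|n IHn].
  under eq_Rintegral do rewrite big_geq //.
  by rewrite Rintegral_cst // mul0r big_geq.
under eq_Rintegral do rewrite big_nat_recr //=.
rewrite Rintegral_bD ?IHn ?big_nat_recr //=; exact: bmeasurable_sum.
Qed.

Variable xi : nat -> T -> R.
Hypothesis mxi : forall i, measurable_fun setT (xi i).
Hypothesis xi1 : forall i w, `|xi i w| <= 1.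
Hypothesis orth : forall i j, (i < j)%N -> \int[P]_w (xi i w * xi j w) = 0.

Let bxi i : bmeasurable (xi i). Proof. by split=> //; exists 1. Qed.

Let S n w := \sum_(0 <= i < n) xi i w.

Let bS n : bmeasurable (S n). Proof. exact: bmeasurable_sum. Qed.

Let bS2 n : bmeasurable (fun w => S n w ^+ 2).
Proof. by under eq_fun do rewrite expr2; exact: bmeasurableM. Qed.

(** The cross term of [S n] with [xi n] integrates to zero, and each square adds at most 1. *)
Lemma orthogonal_sum_square n : \int[P]_w (S n w ^+ 2) <= n%:R.
Proof.
elim: n => [|n IHn].
  under eq_Rintegral do rewrite /S big_geq // expr0n /=.
  by rewrite Rintegral_cst // mul0r.
rewrite (@eq_Rintegral _ _ _ _ _ (fun w =>
    S n w ^+ 2 + (2 * (S n w * xi n w) + xi n w * xi n w))); last first.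
  by move=> w _; rewrite /S big_nat_recr //=; ring.
have bSx : bmeasurable (fun w => S n w * xi n w) by exact: bmeasurableM.
have bxx : bmeasurable (fun w => xi n w * xi n w) by exact: bmeasurableM.
have b2 : bmeasurable (fun w => 2 * (S n w * xi n w)).
  exact: bmeasurableM (bmeasurable_cst _) bSx.
rewrite Rintegral_bD //; last exact: bmeasurableD.
rewrite Rintegral_bD // Rintegral_bZ //.
have -> : \int[P]_w (S n w * xi n w) = 0.
  under eq_Rintegral do rewrite /S mulr_suml.
  rewrite Rintegral_bsum; last by move=> i; exact: bmeasurableM.
  by rewrite big_nat big1 // => i /andP[_ iN]; exact: orth.
rewrite mulr0 add0r -natr1 lerD //.
have -> : 1 = \int[P]_w (cst 1 w) :> R.
  rewrite Rintegral_cst // mul1r; exact: (esym (congr1 fine (probability_setT P))).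
apply: le_Rintegral => //.
- exact: bmeasurable_integrable.
- exact/bmeasurable_integrable/bmeasurable_cst.
- move=> w _ /=; rewrite -expr2 -real_normK ?num_real // expr2.
  by rewrite mulr_ile1.
Qed.

Let sq k := (k.+1 * k.+1)%N.

(** Along squares the second moments of the averages are at most [1 / (k + 1)^2], hence summable.
    The series of squared averages has finite integral, so it is almost surely finite and its terms
    tend to 0. *)
Lemma orthogonal_squares_ae :
  {ae P, forall w, (S (sq k) w / (sq k)%:R) @[k --> \oo] --> 0}.
Proof.
pose f k w : \bar R := ((S (sq k) w / (sq k)%:R) ^+ 2)%:E.
have f0 k w : (0 <= f k w)%E by rewrite lee_fin sqr_ge0.
have bf k : bmeasurable (fun w => (S (sq k) w / (sq k)%:R) ^+ 2).
  have b1 : bmeasurable (fun w => S (sq k) w / (sq k)%:R).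
    exact: bmeasurableM (bS _) (bmeasurable_cst _).
  by under eq_fun do rewrite expr2; exact: bmeasurableM.
have mf k : measurable_fun setT (f k) by apply/measurable_EFinP; case: (bf k).
pose G w := (\sum_(0 <= k <oo) f k w)%E.
have mG : measurable_fun setT G by apply: ge0_emeasurable_sum.
have intf k : (\int[P]_w f k w <= ((sq k)%:R^-1)%:E)%E.
  have -> : (\int[P]_w f k w = (\int[P]_w ((S (sq k) w / (sq k)%:R) ^+ 2))%:E)%E.
    rewrite /Rintegral fineK //.
    exact: integrable_fin_num (bmeasurable_integrable (bf k)).
  rewrite lee_fin.
  under eq_Rintegral do rewrite exprMn mulrC.
  rewrite Rintegral_bZ // exprVn ler_pdivrMl ?exprn_gt0 ?ltr0n //.
  rewrite expr2 mulfK ?pnatr_eq0 //; exact: orthogonal_sum_square.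
have intG : (\int[P]_w G w < +oo)%E.
  rewrite integral_nneseries //.
  apply: (@le_lt_trans _ _ 2%:E); last by rewrite ltry.
  apply: (le_trans (lee_nneseries _ (fun k _ => intf k))).
    by move=> k _ _; exact: integral_ge0.
  apply: lime_le; first by apply: is_cvg_nneseries => k _ _; rewrite lee_fin invr_ge0.
  apply: nearW => n; rewrite sumEFin lee_fin.
  case: n => [|n]; first by rewrite big_geq.
  (* Strengthened so that the induction telescopes, via [1 / (y + 1)^2 <= 1 / y - 1 / (y + 1)]. *)
  suff : \sum_(0 <= k < n.+1) ((sq k)%:R^-1 : R) <= 2 - n.+1%:R^-1.
    by move=> h; apply: (le_trans h); rewrite gerBl invr_ge0.
  elim: n => [|n IHn]; first by rewrite big_nat1 !invr1 lerBrDr.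
  rewrite big_nat_recr //=; apply: le_trans (lerD IHn (lexx _)) _.
  rewrite /sq natrM invfM -[n.+2%:R]natr1.
  have : (0 : R) < n.+1%:R by rewrite ltr0n.
  move: (n.+1%:R : R) => y y0.
  have y1 : 0 < y + 1 by rewrite ltr_wpDr.
  have h : (y + 1)^-1 * (y + 1)^-1 <= y^-1 * (y + 1)^-1.
    rewrite ler_wpM2r ?invr_ge0 ?(ltW y1) // lef_pV2 ?posrE // lerDl //.
  have e : y^-1 * (y + 1)^-1 = y^-1 - (y + 1)^-1 by field; rewrite !gt_eqF.
  by rewrite -addrA lerD2l addrC lerBlDr [leRHS]addrC -e.
have iG : P.-integrable setT G.
  apply/integrableP; split=> //; apply: le_lt_trans intG.
  rewrite le_eqVlt; apply/orP; left; apply/eqP; apply: eq_integral => w _.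
  by rewrite gee0_abs //; apply: nneseries_ge0.
apply: filterS (integrable_ae measurableT iG) => w /(_ Logic.I) Gfin.
have tail := @nneseries_tail_cvg _ (f^~ w) xpredT
  ltac:(by rewrite -ge0_fin_numE // nneseries_ge0) (fun k _ => f0 k w).
have f_cvg : f k w @[k --> \oo] --> 0%E.
  apply: (squeeze_cvge (f := fun=> 0%E) _ _ tail); last exact: cvg_cst.
  apply: nearW => k; rewrite f0 /= (@nneseries_split _ (f^~ w) k 1) //.
  by rewrite addn1 big_nat1 leeDl // nneseries_ge0.
move/fine_cvgP : f_cvg => [_ f_cvg].
apply/cvgr0Pnorm_le => e e0.
move/cvgr0Pnorm_le : f_cvg => /(_ (e ^+ 2)) []; first by rewrite exprn_gt0.
move=> N _ hN; exists N => // k /= Nk; have := hN k Nk; rewrite /= ger0_norm ?sqr_ge0 //.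
by rewrite -real_normK ?num_real // ler_sqr ?nnegrE // ltW.
Qed.

(** Consecutive squares differ by [2k + 3], so with terms bounded by 1 the sums between them move by
    at most [3 * k.+1], negligible against [sq k]. *)
Lemma bounded_orthogonal_slln :
  {ae P, forall w, (S n w / n%:R) @[n --> \oo] --> 0}.
Proof.
apply: filterS orthogonal_squares_ae => w /cvgr0Pnorm_le h.
apply/cvgr0Pnorm_le => e e0.
have e2 : 0 < e / 2 by rewrite divr_gt0.
have [N _ hN] := h _ e2.
(* From [L] on, [3 / k.+1] is at most [e / 2], which absorbs the gap between squares. *)
pose L := maxn N (Num.truncn (3 / (e / 2))).
exists (sq L) => // n /= Ln.
have [k [k1 k2]] : exists k, (sq k <= n < sq k.+1)%N /\ (L <= k)%N.
  have ex : exists k, (sq k <= n)%N by exists L.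
  have ub k : (sq k <= n)%N -> (k <= n)%N by rewrite /sq; nia.
  case: (ex_maxnP ex ub) => k kn kmax; exists k; split.
    by rewrite kn ltnNge; apply/negP => /kmax; rewrite ltnn.
  exact: kmax.
have /andP[kn nk] := k1.
have diff i : `|S (sq k + i)%N w| <= `|S (sq k) w| + i%:R.
  elim: i => [|i IHi]; first by rewrite addn0 addr0.
  rewrite addnS /S big_nat_recr //= -/(S _ _).
  rewrite (le_trans (ler_normD _ _)) // -natr1 addrA lerD //.
have kpos : (0 : R) < (sq k)%:R by rewrite ltr0n.
have npos : (0 : R) < n%:R by rewrite ltr0n; apply: leq_trans kn.
have hk := hN k (leq_trans (leq_maxl _ _) k2).
rewrite normrM normfV (ger0_norm (ltW kpos)) ler_pdivrMr // in hk.
rewrite normrM normfV (ger0_norm (ltW npos)) ler_pdivrMr //.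
have := diff (n - sq k)%N; rewrite subnKC // => dn; apply: (le_trans dn).
have gap : (n - sq k)%:R <= e / 2 * (sq k)%:R.
  apply: (@le_trans _ _ (3 * k.+1%:R)).
    rewrite -natrM ler_nat; move: nk; rewrite /sq; nia.
  rewrite /sq natrM mulrA ler_wpM2r // mulrC -ler_pdivrMr //.
  apply: ltW; apply: lt_le_trans (truncnS_gt _) _; rewrite ler_nat ltnS.
  by apply: leq_trans k2; rewrite leq_maxr.
apply: (le_trans (lerD hk gap)).
rewrite -mulrDl -splitr ler_wpM2l ?(ltW e0) // ler_nat //.
Qed.

End Orthogonal.

(** * The stationary chain *)

Definition block {T : Type} (M : nat -> T -> nat) j n w : seq nat :=
  mkseq (fun i => M (j + i)%N w) n.

Section Chain.
Context {d : measure_display} {T : measurableType d} {R : realType}.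
Variable P : probability T R.
Variables (Q : nat -> nat -> R) (pi : nat -> R) (M : nat -> {RV P >-> nat}).
Hypothesis Q0 : forall i j, 0 <= Q i j.
Hypothesis pi_stat : stationary_dist Q pi.
Hypothesis M_chain : markov_chain Q pi M.

Lemma chain_fibers i : fiber_measurable (M i).
Proof.
by move=> c; rewrite -[X in measurable X]setTI; apply: (measurable_funPT (M i)).
Qed.

Lemma block_fibers j n : fiber_measurable (block M j n).
Proof.
exact: (@fiber_measurable_path _ _ _ (fun i => M (j + i)%N) n
  (fun i => chain_fibers _)).
Qed.

Lemma block_eq j n c w : block M j n w = c <->
  size c = n /\ forall i, (i < n)%N -> M (j + i)%N w = nth 0%N c i.
Proof.
split=> [<-|[sc cE]].
  by rewrite size_mkseq; split=> // i iN; rewrite nth_mkseq.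
apply: (@eq_from_nth _ 0%N); first by rewrite size_mkseq.
by move=> i; rewrite size_mkseq => iN; rewrite nth_mkseq // cE.
Qed.

Lemma drop_block j n w : drop j (block M 0 (j + n) w) = block M j n w.
Proof.
apply: (@eq_from_nth _ 0%N); first by rewrite size_drop !size_mkseq addKn.
move=> i; rewrite size_drop size_mkseq addKn => iN.
by rewrite nth_drop !nth_mkseq // ltn_add2l.
Qed.

(** The Markov property is given for single paths; all paths in [A] end at [i] and share the factor
    [Q i j], so it can be summed over them. *)
Lemma markov_block n (A : set (seq nat)) i j :
  (forall s, A s -> nth 0%N s n = i) ->
  P ((M n.+1 @^-1` [set j]) `&` (block M 0 n.+1 @^-1` A)) =
  (P (block M 0 n.+1 @^-1` A) * (Q i j)%:E)%E.
Proof.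
move=> Ai; rewrite -[X in (P X * _)%E]setTI; apply: eq_measure_fibers => //.
- exact: block_fibers.
- exact: block_fibers.
- exact: chain_fibers.
- move=> c Ac; rewrite setTI.
  have [sc|sc] := eqVneq (size c) n.+1; last first.
    have b0 : block M 0 n.+1 @^-1` [set c] = set0.
      apply/seteqP; split=> w //= /block_eq[sc' _].
      by rewrite sc' eqxx in sc.
    by rewrite b0 setI0 measure0 mul0e.
  pose m k := if (k <= n)%N then nth 0%N c k else j.
  have e1 : block M 0 n.+1 @^-1` [set c] =
      [set w | forall k, (k <= n)%N -> M k w = m k].
    apply/seteqP; split=> w /=.
      by move=> /block_eq[_ h] k kn; rewrite /m kn -h.
    by move=> h; apply/block_eq; split=> // k kn; rewrite h // /m ifT.
  have e2 : M n.+1 @^-1` [set j] `&` block M 0 n.+1 @^-1` [set c] =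
      [set w | forall k, (k <= n.+1)%N -> M k w = m k].
    rewrite e1; apply/seteqP; split=> w /=.
      move=> [Mj h] k; rewrite leq_eqVlt => /orP[/eqP ->|kn]; last exact: h.
      by rewrite /m ltnn.
    move=> h; split; first by rewrite h // /m ltnn.
    by move=> k kn; rewrite h // ltnW.
  by rewrite e2 e1 (M_chain.2 n m) /m leqnn ltnn (Ai _ Ac).
Qed.

Let cyl (j n : nat) (m : nat -> nat) :=
  [set w | forall i, (i <= n)%N -> M (j + i)%N w = m i].

Let cylE j n m : cyl j n m = block M j n.+1 @^-1` [set mkseq m n.+1].
Proof.
apply/seteqP; split=> w /=.
  move=> h; apply/block_eq; rewrite size_mkseq; split=> // i iN.
  by rewrite nth_mkseq // h.
by move=> /block_eq[_ h] i iN; rewrite h // nth_mkseq.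
Qed.

Let measurable_cyl j n m : measurable (cyl j n m).
Proof. rewrite cylE; exact: block_fibers. Qed.

(** Summing over the value of [M 0], the base case is the invariance of [pi], and the inductive step
    multiplies both sides by the same transition probability. *)
Lemma chain_shift1 n (m : nat -> nat) : P (cyl 1 n m) = P (cyl 0 n m).
Proof.
elim: n => [|n IHn].
  have -> : cyl 0 0 m = [set w | M 0%N w = m 0%N].
    apply/seteqP; split=> w /=; first by move=> /(_ 0%N); exact.
    by move=> h [|].
  rewrite M_chain.1 -pi_stat.2.
  rewrite (measure_fibers P (@chain_fibers 0%N) (measurable_cyl _ _ _)).
  apply: eq_eseriesr => k _.
  have := M_chain.2 0%N (fun i => if i is i'.+1 then m i' else k) => /=.
  have -> : [set w | forall i, (i <= 0)%N -> M i w = if i is i'.+1 then m i' else k] =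
      [set w | M 0%N w = k].
    apply/seteqP; split=> w /=; first by move=> /(_ 0%N); exact.
    by move=> h [|].
  rewrite M_chain.1 -EFinM => <-; congr (P _); apply/seteqP; split=> w /=.
    by move=> [h Mk] [|[|]] // _; exact: (h 0%N).
  move=> h; split; last exact: (h 0%N).
  by move=> [|] // _; exact: (h 1%N).
have step0 : P (cyl 0 n.+1 m) = (P (cyl 0 n m) * (Q (m n) (m n.+1))%:E)%E.
  exact: M_chain.2.
rewrite step0 -IHn -[cyl 1 n.+1 m]setIT -[cyl 1 n m]setIT -(preimage_setT (M 0%N)).
apply: eq_measure_fibers => //; try exact: chain_fibers; try exact: measurable_cyl.
move=> k _.
have e l : cyl 1 l m `&` M 0%N @^-1` [set k] =
    [set w | forall i, (i <= l.+1)%N -> M i w = if i is i'.+1 then m i' else k].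
  apply/seteqP; split=> w /=; first by move=> [h Mk] [|i] // il; exact: h.
  by move=> h; split=> [i il|]; [exact: (h i.+1)|exact: (h 0%N)].
by rewrite !e; exact: (M_chain.2 n.+1 (fun i => if i is i'.+1 then m i' else k)).
Qed.

Lemma chain_stationary j n (A : set (seq nat)) :
  P (block M j n @^-1` A) = P (block M 0 n @^-1` A).
Proof.
have shift1 l B : P (block M 1 l @^-1` B) = P (block M 0 l @^-1` B).
  rewrite -[P (block M 0 l @^-1` B)]mule1 -[X in P X = _]setTI -[X in (P X * _)%E]setTI.
  apply: eq_measure_fibers => //; try exact: block_fibers.
  move=> c _; rewrite !setTI mule1.
  case: l => [|l].
    by rewrite (_ : block M 1 0 = block M 0 0).
  have [sc|sc] := eqVneq (size c) l.+1.
    have -> : c = mkseq (nth 0%N c) l.+1 by rewrite -sc mkseq_nth.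
    by rewrite -!cylE chain_shift1.
  have b0 j' : block M j' l.+1 @^-1` [set c] = set0.
    apply/seteqP; split=> w //= /block_eq[sc' _].
    by rewrite sc' eqxx in sc.
  by rewrite !b0.
elim: j => [//|j <-].
(* A block at [j] is the tail of a longer block at 0, so a shift by one of the longer block shifts
   it too. *)
have -> : block M j n = drop j \o block M 0 (j + n).
  by apply/funext => w /=; rewrite drop_block.
have -> : block M j.+1 n = drop j \o block M 1 (j + n).
  apply/funext => w /=; rewrite -drop_block.
  apply: (@eq_from_nth _ 0%N).
    by rewrite !size_drop !size_mkseq; lia.
  move=> i; rewrite size_drop size_mkseq => iN.
  by rewrite !nth_drop !nth_mkseq ?addSn //; lia.
exact: (shift1 (j + n)%N (drop j @^-1` A)).
Qed.

End Chain.

(** * The maximal inequality *)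

Definition overcrowded (f : nat -> bool) q L j : bool :=
  [exists n : 'I_L.+1, (0 < n)%N && (n < q * \sum_(j <= i < j + n) f i)%N].

(* The intervals witnessing [overcrowded] can be chosen disjoint from left to
   right, and each is shorter than [q] times the number of [f] it contains. *)
Lemma overcrowded_cover (f : nat -> bool) q L N a :
  (\sum_(a <= j < a + N) overcrowded f q L j <=
   q * \sum_(a <= i < a + N + L) f i)%N.
Proof.
have [n] := ubnP N; elim: n N a => // n IHn [|N] a Nn.
  by rewrite addn0 big_geq.
case: (boolP (overcrowded f q L a)) => [/existsP[[k kL] /= /andP[k0 hk]]|ha].
  have le1 b c : (\sum_(b <= j < c) overcrowded f q L j <= c - b)%N.
    apply: (@leq_trans (\sum_(b <= j < c) 1)%N); last by rewrite sum_nat_const_nat muln1.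
    by apply: leq_sum => j _; case: overcrowded.
  (* A witnessing interval may overrun the window; its length is at most [L], so it stays within the
     [L] extra positions on the right. *)
  have [Nk|kN] := leqP N.+1 k.
    apply: (leq_trans (le1 _ _)); apply: (@leq_trans k); first lia.
    apply: (leq_trans (ltnW hk)); rewrite leq_mul2l.
    rewrite [leqRHS](@big_cat_nat _ _ _ (a + k)) /=; try lia.
  rewrite (@big_cat_nat _ _ _ (a + k)) /=; try lia.
  rewrite [X in (_ <= _ * X)%N](@big_cat_nat _ _ _ (a + k)) /=; try lia.
  rewrite mulnDr leq_add //.
    apply: (leq_trans (le1 _ _)); rewrite addKn; exact: ltnW.
  have := IHn (N.+1 - k)%N (a + k)%N ltac:(lia).
  by rewrite (_ : a + k + (N.+1 - k) = a + N.+1)%N; last lia.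
rewrite big_ltn; last lia.
rewrite (negbTE ha) add0n.
have := IHn N a.+1 ltac:(lia); rewrite addSnnS => h; apply: (leq_trans h).
rewrite leq_mul2l [leqRHS]big_ltn ?leq_addl ?orbT //; lia.
Qed.

Section Maximal.
Context {d : measure_display} {T : measurableType d} {R : realType}.
Variable P : probability T R.

Lemma Rintegral_indic (A : set T) : measurable A ->
  \int[P]_w \1_A w = fine (P A).
Proof. by move=> mA; rewrite /Rintegral integral_indic // setIT. Qed.

Variables (Q : nat -> nat -> R) (pi : nat -> R) (M : nat -> {RV P >-> nat}).
Hypothesis Q0 : forall i j, 0 <= Q i j.
Hypothesis pi_stat : stationary_dist Q pi.
Hypothesis M_chain : markov_chain Q pi M.

Let high K i := M i @^-1` [set k | (K < k)%N].
Let crowd q K L j :=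
  [set w | overcrowded (fun i => (K < M i w)%N) q L j].

Let measurable_high K i : measurable (high K i).
Proof. exact: measurable_fibers (chain_fibers M i). Qed.

Let crowdE q K L j : crowd q K L j =
  block M j L @^-1` [set s | overcrowded (fun i => (K < nth 0%N s i)%N) q L 0].
Proof.
suff e w : overcrowded (fun i => (K < M i w)%N) q L j =
    overcrowded (fun i => (K < nth 0%N (block M j L w) i)%N) q L 0.
  by apply/seteqP; split=> w; rewrite /crowd /= e.
apply: eq_existsb => n; congr (_ && (_ < _ * _)%N).
rewrite -{1}[j]add0n big_addn addKn add0n; apply: eq_big_nat => i iN.
rewrite nth_mkseq ?[(j + i)%N]addnC //; have := ltn_ord n; lia.
Qed.

(** Integrating the covering inequality over a window of length [N], stationarity gives
    [N * b <= q * (N + L) * c]; the boundary term involving [L] is negligible for large [N]. *)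
Lemma maximal_finite q K L :
  fine (P (crowd q K L 0)) <= q%:R * fine (P (high K 0)).
Proof.
have mc j : measurable (crowd q K L j).
  by rewrite crowdE; apply: measurable_fibers; exact: block_fibers.
set b := fine (P (crowd q K L 0)); set c := fine (P (high K 0)).
have key N : N%:R * b <= q%:R * ((N + L)%:R * c).
  have <- : \int[P]_w (\sum_(0 <= j < N) \1_(crowd q K L j) w) = N%:R * b.
    rewrite Rintegral_bsum; last by move=> i; exact: bmeasurable_indic.
    rewrite (eq_bigr (fun=> b)); first by rewrite big_const_nat iter_addr_0 subn0 mulr_natl.
    move=> j _; rewrite Rintegral_indic // crowdE.
    by rewrite (chain_stationary Q0 pi_stat M_chain) -crowdE.
  have <- : \int[P]_w (q%:R * \sum_(0 <= i < N + L) \1_(high K i) w) = q%:R * ((N + L)%:R * c).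
    rewrite Rintegral_bZ; last by apply: bmeasurable_sum => i; exact: bmeasurable_indic.
    congr (_ * _); rewrite Rintegral_bsum; last by move=> i; exact: bmeasurable_indic.
    rewrite (eq_bigr (fun=> c)); first by rewrite big_const_nat iter_addr_0 subn0 mulr_natl.
    move=> j _; rewrite Rintegral_indic //.
    have hE i : high K i = block M i 1 @^-1` [set s | (K < nth 0%N s 0)%N].
      by apply/seteqP; split=> w /=; rewrite addn0.
    by rewrite hE (chain_stationary Q0 pi_stat M_chain) -hE.
  apply: le_Rintegral => //.
  - by apply: bmeasurable_integrable; apply: bmeasurable_sum => i; exact: bmeasurable_indic.
  - apply: bmeasurable_integrable; apply: bmeasurableM; first exact: bmeasurable_cst.
    by apply: bmeasurable_sum => i; exact: bmeasurable_indic.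
  - move=> w _; have := overcrowded_cover (fun i => (K < M i w)%N) q L N 0.
    rewrite add0n -(ler_nat R) natrM !natr_sum; congr (_ <= _ * _);
      by apply: eq_bigr => i _; rewrite indicE; congr (_%:R); congr nat_of_bool;
         apply/idP/idP; rewrite inE.
rewrite leNgt; apply/negP => lt.
have bc : 0 < b - q%:R * c by rewrite subr_gt0.
have c0 : 0 <= c by exact: fine_ge0.
(* Long enough for [N * (b - q * c)] to exceed the boundary term [q * L * c], which contradicts
   [key]. *)
pose N := (Num.truncn (q%:R * (L%:R * c) / (b - q%:R * c))).+1.
have kN : N%:R * (b - q%:R * c) <= q%:R * (L%:R * c).
  rewrite mulrBr lerBlDl; apply: (le_trans (key N)).
  by rewrite natrD mulrDl mulrDr mulrCA.
have := lt_le_trans (truncnS_gt (q%:R * (L%:R * c) / (b - q%:R * c))) (lexx N%:R).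
by rewrite ltr_pdivrMr // ltNge kN.
Qed.

(** By the maximal inequality, level [K] fails for some [n] with probability at most [q.+1] times
    that of [M 0 > K], which tends to 0 with [K]. Hence almost surely some level never fails. *)
Lemma above_rare_ae :
  {ae P, forall w, forall q, exists K, forall n, (q.+1 * above (M^~ w) K n <= n)%N}.
Proof.
apply: ae_foralln => q.
pose U K := \bigcup_L crowd q.+1 K L 0.
have mc K L : measurable (crowd q.+1 K L 0).
  by rewrite crowdE; apply: measurable_fibers; exact: block_fibers.
have mU K : measurable (U K) by exact: bigcup_measurable.
have PU K : (P (U K) <= q.+1%:R%:E * P (high K 0))%E.
  have h : P (crowd q.+1 K L 0) @[L --> \oo] --> P (U K).
    apply: nondecreasing_cvg_mu => //; first exact: mU.
    move=> L L' LL'; apply/subsetPset => w.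
    move=> /existsP[[n nL] nh]; apply/existsP.
    by exists (Ordinal (leq_trans nL (LL' : L < L'.+1)%N)).
  rewrite -(cvg_lim (@ereal_hausdorff R) h); apply: lime_le.
    by apply/cvg_ex; exists (P (U K)).
  apply: nearW => L; rewrite -[leLHS]fineK ?fin_num_measure //.
  rewrite -[X in (_ <= _ * X)%E]fineK ?fin_num_measure //.
  exact: maximal_finite.
have high0 : P (high K 0) @[K --> \oo] --> 0%E.
  have e : \bigcap_K high K 0 = set0.
    apply/seteqP; split=> w //= /(_ (M 0%N w) I); by rewrite /high /= ltnn.
  rewrite -(measure0 P) -e; apply: nonincreasing_cvg_mu => //.
  - exact: le_lt_trans (probability_le1 _ _) (ltry _).
  - by rewrite e.
  - by move=> K K' KK'; apply/subsetPset => w; exact: leq_ltn_trans.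
have N0 : P (\bigcap_K U K) = 0%E.
  apply/eqP; rewrite eq_le measure_ge0 andbT.
  have h0 : (q.+1%:R%:E * P (high K 0))%E @[K --> \oo] --> 0%E.
    by rewrite -(mule0 q.+1%:R%:E); apply: cvgeZl.
  rewrite -(cvg_lim (@ereal_hausdorff R) h0); apply: lime_ge.
    by apply/cvg_ex; exists 0%E.
  apply: nearW => K; apply: le_trans (PU K); apply: le_measure; rewrite ?inE //.
    exact: bigcap_measurable.
  exact: bigcap_inf.
apply: (@ae_off_negligible _ _ _ _ (\bigcap_K U K)).
  by exists (\bigcap_K U K); split=> //; exact: bigcap_measurable.
move=> w Uw; apply: contrapT => none; apply: Uw => K _.
apply: contrapT => nU; apply: none; exists K => n.
rewrite leqNgt; apply/negP => hn; apply: nU; exists n => //=.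
(* The length bound is taken to be [n] itself, so the whole initial segment is the witness. *)
apply/existsP; exists ord_max => /=; rewrite add0n.
by case: n hn => [|n] //; rewrite /above big_geq ?muln0.
Qed.

End Maximal.

(** * The renewal chain *)

Section Renewal.
Context {d : measure_display} {T : measurableType d} {R : realType}.
Variable P : probability T R.
Variables (p : nat -> R) (pi : nat -> R) (M : nat -> {RV P >-> nat}).
Hypotheses (p_dist : prob_dist p) (p_mean : finite_mean p).
Hypothesis pi_stat : stationary_dist (renewal_kernel p) pi.
Hypothesis M_chain : markov_chain (renewal_kernel p) pi M.

Let p0 k : 0 <= p k. Proof. by case: p_dist. Qed.

Lemma renewal_kernel_ge0 i j : 0 <= renewal_kernel p i j.
Proof. by case: i => [|i] /=. Qed.

Let p1 k : p k <= 1.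
Proof.
rewrite -lee_fin; case: p_dist => _ <-.
rewrite (@nneseriesD1 _ _ k) //; last by move=> i _; rewrite lee_fin.
by rewrite leeDl // nneseries_ge0 // => i _ _; rewrite lee_fin.
Qed.

(** The kernel gives no mass to a step from [i.+1] to [j] other than [i], and there are countably
    many triples [(n, i, j)]. *)
Lemma descends_ae : {ae P, forall w, descends (M^~ w)}.
Proof.
suff h n i j : {ae P, forall w, M n w = i.+1 -> M n.+1 w = j -> j = i}.
  have := ae_foralln (fun n => ae_foralln (fun i => ae_foralln (h n i))).
  apply: filterS => w hw n; case e : (M n w) => [|i] // _.
  exact: hw e erefl.
have [->|ji] := eqVneq j i; first by apply: aeW.
pose A : set (seq nat) := [set s | nth 0%N s n = i.+1].
have := @markov_block _ _ _ P _ _ M renewal_kernel_ge0 M_chain n A i.+1 j (fun s h => h).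
rewrite /= (negbTE ji) mule0 => N0.
apply: (ae_off_negligible (N := M n.+1 @^-1` [set j] `&` block M 0 n.+1 @^-1` A)).
  exists (M n.+1 @^-1` [set j] `&` block M 0 n.+1 @^-1` A); split=> //.
  apply: measurableI; first exact: chain_fibers.
  by apply: measurable_fibers; exact: block_fibers.
move=> w Nw Mn Mn1; exfalso; apply: Nw; split=> //.
by rewrite /A /= nth_mkseq.
Qed.

Let nth_block n i w : (i < n)%N -> nth 0%N (block M 0 n w) i = M i w.
Proof. by move=> iN; rewrite nth_mkseq. Qed.

Let preim_block n i k : (i < n)%N ->
  block M 0 n @^-1` [set s | nth 0%N s i = k] = M i @^-1` [set k].
Proof.
by move=> iN; apply/seteqP; split=> w; rewrite /preimage /mkset nth_block.
Qed.

Let V i := M i @^-1` [set 0%N].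
Let U k i := V i `&` M i.+1 @^-1` [set k].

Let mV i : measurable (V i). Proof. exact: chain_fibers. Qed.
Let mU k i : measurable (U k i).
Proof. by apply: measurableI => //; exact: chain_fibers. Qed.

(** Martingale differences: given the past up to time [i], the first term has conditional mean equal
    to the second. Their sum over [i < n] is [runs] minus [p k] times [zeros]. *)
Let xi k i w : R := \1_(U k i) w - p k * \1_(V i) w.

Let bindic A : measurable A -> bmeasurable (\1_A : T -> R).
Proof. exact: bmeasurable_indic. Qed.

Lemma renewal_step n (A : set (seq nat)) k :
  (forall s, A s -> nth 0%N s n = 0%N) ->
  P ((M n.+1 @^-1` [set k]) `&` (block M 0 n.+1 @^-1` A)) =
  (P (block M 0 n.+1 @^-1` A) * (p k)%:E)%E.
Proof. exact: (markov_block renewal_kernel_ge0 M_chain). Qed.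

(** For an event of the past up to [j], the step from a zero at [j] goes to [k] with probability
    [p k] independently of it, so the two terms cancel. *)
Lemma indic_step_orthogonal k j (A : set (seq nat)) :
  \int[P]_w (\1_(block M 0 j.+1 @^-1` A) w * xi k j w) = 0.
Proof.
set E := block M 0 j.+1 @^-1` A.
have mE : measurable E by apply: measurable_fibers; exact: block_fibers.
have mEV : measurable (E `&` V j) by exact: measurableI.
have mEU : measurable (E `&` U k j) by exact: measurableI.
rewrite (@eq_Rintegral _ _ _ _ _ (fun w =>
    \1_(E `&` U k j) w + (- p k) * \1_(E `&` V j) w)); last first.
  by move=> w _; rewrite /xi !indicI /=; ring.
rewrite Rintegral_bD; first last.
- by apply: bmeasurableM; [exact: bmeasurable_cst|exact: bindic].
- exact: bindic.
rewrite Rintegral_bZ; last exact: bindic.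
rewrite !Rintegral_indic //.
pose B := A `&` [set s | nth 0%N s j = 0%N].
have EV : E `&` V j = block M 0 j.+1 @^-1` B.
  by rewrite preimage_setI preim_block.
have EU : E `&` U k j = (M j.+1 @^-1` [set k]) `&` (block M 0 j.+1 @^-1` B).
  by rewrite -EV /U setIA setIC.
rewrite EU renewal_step; last by move=> s [].
rewrite -EV fineM ?fin_num_measure //=; ring.
Qed.

Lemma runs_freq_ae k : {ae P, forall w, ((runs (M^~ w) k n)%:R -
  p k * (zeros (M^~ w) n)%:R) / n%:R @[n --> \oo] --> (0 : R)}.
Proof.
have bxi i : bmeasurable (xi k i).
  rewrite (_ : xi k i = fun w => \1_(U k i) w + (- p k) * \1_(V i) w).
    apply: bmeasurableD; first exact: bindic.
    by apply: bmeasurableM; [exact: bmeasurable_cst|exact: bindic].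
  by apply/funext => w; rewrite mulNr.
have := @bounded_orthogonal_slln _ _ _ P (xi k) (fun i => (bxi i).1).
have xi1 i w : `|xi k i w| <= 1.
  rewrite /xi /U indicI /= !indicE.
  case: (w \in V i); case: (w \in _); 
    rewrite /= ?(mul0r, mul1r, mulr1, mulr0, mulr1n, mulr0n, subr0, sub0r,
                 normr0, normr1, normrN) //.
    by rewrite ger0_norm ?subr_ge0 // gerBl.
  by rewrite ger0_norm.
have orth i j : (i < j)%N -> \int[P]_w (xi k i w * xi k j w) = 0.
  move=> ij.
  pose AV := [set s : seq nat | nth 0%N s i = 0%N].
  pose AU := AV `&` [set s : seq nat | nth 0%N s i.+1 = k].
  (* Both events in [xi k i] belong to the past of [j]: the later time they involve is
     [i.+1 <= j]. *)
  have eV : V i = block M 0 j.+1 @^-1` AV by rewrite preim_block // ltnS ltnW.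
  have eU : U k i = block M 0 j.+1 @^-1` AU.
    rewrite /AU preimage_setI -eV /U; congr (_ `&` _).
    by rewrite preim_block.
  rewrite (@eq_Rintegral _ _ _ _ _ (fun w => \1_(U k i) w * xi k j w +
     (- p k) * (\1_(V i) w * xi k j w))); last first.
    by move=> w _; rewrite {1}/xi; ring.
  have bU : bmeasurable (fun w => \1_(U k i) w * xi k j w).
    by apply: bmeasurableM => //; exact: bindic.
  have bV : bmeasurable (fun w => \1_(V i) w * xi k j w).
    by apply: bmeasurableM => //; exact: bindic.
  rewrite Rintegral_bD //; last by apply: bmeasurableM => //; exact: bmeasurable_cst.
  rewrite Rintegral_bZ // eU eV !indic_step_orthogonal; ring.
move=> /(_ xi1 orth); apply: filterS => w.
rewrite (_ : (fun n => _) = (fun n => ((runs (M^~ w) k n)%:R -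
  p k * (zeros (M^~ w) n)%:R) / n%:R)) //; apply/funext => n; congr (_ / _).
rewrite /runs /zeros !natr_sum mulr_sumr -sumrB; apply: eq_bigr => i _.
rewrite /xi /U indicI /= !indicE.
have -> : (w \in V i) = (M i w == 0%N) by apply/idP/eqP; rewrite inE.
have -> : (w \in M i.+1 @^-1` [set k]) = (M i.+1 w == k) by apply/idP/eqP; rewrite inE.
by case: (_ == _); case: (_ == _); rewrite ?mul1r ?mul0r.
Qed.

(** * The conditional expectation of the residual run *)

Let X n w := M n w != 0%N.

Lemma measurable_sigma n :
  measurable_fun setT (fun v => sigma (traj X v) n : \bar R).
Proof.
pose B l := [set v | forall j, (n < j <= n + l)%N -> X j v].
have mB l : measurable (B l).
  rewrite (_ : B l = \bigcap_(j in [set j | (n < j <= n + l)%N]) (M j @^-1` [set k | k != 0%N])).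
    by apply: bigcap_measurableType => j _; apply: measurable_fibers; exact: chain_fibers.
  by apply/seteqP; split.
(* A countable supremum of measurable functions. Lengths that fail contribute 0, which is harmless
   because length 0 is always admissible. *)
have -> : (fun v => sigma (traj X v) n : \bar R) =
    (fun v => esups (fun l => (l%:R * \1_(B l) v)%:E) 0%N).
  apply/funext => v; apply/eqP; rewrite eq_le; apply/andP; split.
    apply: ge_ereal_sup => _ [l /= Bl <-]; apply: ereal_sup_ubound.
    by exists l => //=; rewrite indicE mem_set // mulr1.
  apply: ge_ereal_sup => _ [l /= _ <-]; rewrite indicE.
  case: (boolP (v \in B l)) => [|_].
    rewrite inE => Bl; rewrite mulr1; apply: ereal_sup_ubound.
    by exists l.
  rewrite mulr0; apply: ereal_sup_ubound; exists 0%N => //= j.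
  by rewrite addn0 => /andP[/leq_trans h /h]; rewrite ltnn.
apply: measurable_fun_esups => l; apply/measurable_EFinP.
by apply: measurable_funM => //; apply: measurable_indic.
Qed.

Lemma integral_next n (A : set (seq nat)) (h : nat -> R) :
  (forall s, A s -> nth 0%N s n = 0%N) -> (forall k, 0 <= h k) ->
  (\int[P]_(v in block M 0 n.+1 @^-1` A) (h (M n.+1 v))%:E =
   P (block M 0 n.+1 @^-1` A) * wsum h p)%E.
Proof.
move=> A0 h0; set C := block M 0 n.+1 @^-1` A.
have mC : measurable C by apply: measurable_fibers; exact: block_fibers.
rewrite integral_nat_valued //; last exact: chain_fibers.
rewrite -[P C]fineK ?fin_num_measure // /wsum -nneseriesZl; last first.
  by move=> k _; rewrite lee_fin mulr_ge0.
apply: eq_eseriesr => k _; rewrite setIC renewal_step // fineK ?fin_num_measure //.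
by rewrite EFinM muleCA.
Qed.

(* Up to a null set, the atom of [w] is the event that the run opened by the
   last zero [z] has length at least [tau], intersected with an event of the
   past of [z]; there [sigma] is the length of that run minus [tau]. *)
Lemma theta_renewal w n : descends (M^~ w) -> P (atom X n w) != 0%E ->
  (psi (traj X w) <= n)%N ->
  0 < tail_prob p (tau (traj X w) n) /\
  theta P X n w = (residual_mean p (tau (traj X w) n))%:E.
Proof.
move=> dw Pw psin; have [tn mz x1] := tau_spec dw psin.
rewrite -/(traj X w) in tn mz x1; set t := tau (traj X w) n in tn mz x1 *.
set z := (n - t)%N in mz x1.
pose A := [set s : seq nat | forall i, (i <= z)%N -> (nth 0%N s i != 0%N) = X i w].
have A0 s : A s -> nth 0%N s z = 0%N.
  by move=> /(_ z (leqnn z)); rewrite /X mz eqxx => /negbFE/eqP.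
set C := block M 0 z.+1 @^-1` A.
have mC : measurable C by apply: measurable_fibers; exact: block_fibers.
have matom : measurable (atom X n w).
  rewrite (_ : atom X n w = \bigcap_(i in [set i | (i <= n)%N])
      (M i @^-1` [set k | (k != 0%N) = X i w])).
    by apply: bigcap_measurableType => j _; apply: measurable_fibers; exact: chain_fibers.
  by apply/seteqP; split.
have atomC v : atom X n w v -> C v.
  by move=> av i iz; rewrite nth_mkseq // add0n; apply: av; lia.
have CE v : C v -> forall i, (i <= z)%N -> X i v = X i w.
  by move=> Cv i iz; rewrite -(Cv i iz) nth_mkseq.
have atomE v : descends (M^~ v) -> C v -> (atom X n w v <-> (t <= M z.+1 v)%N).
  move=> dv Cv; rewrite -(ones_descend dv z t) (_ : z + t = n)%N; last by rewrite /z; lia.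
  split=> [av j jz|xv j jn].
    rewrite /ones_of -[_ != _]/(X j v) av; last by case/andP: jz.
    exact: x1.
  have [jz|zj] := leqP j z; first exact: CE.
  have zjn : (z < j <= n)%N by rewrite zj.
  by rewrite [LHS](xv j zjn) [RHS](x1 j zjn).
(* On [C] outside the atom the run opened at [z] is almost surely shorter than [t], where [h]
   vanishes. The integral thus extends to the past event [C] and factors; [f = 1] gives the mass of
   the atom, and [sigma] the numerator of [theta]. *)
have atom_int (f : T -> \bar R) (h : nat -> R) : measurable_fun setT f ->
    (forall k, 0 <= h k) -> (forall k, (k < t)%N -> h k = 0) ->
    (forall v, descends (M^~ v) -> atom X n w v -> f v = (h (M z.+1 v))%:E) ->
    (\int[P]_(v in atom X n w) f v = P C * wsum h p)%E.
  move=> mf h0 ht fh; rewrite -integral_next //.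
  rewrite integral_mkcond [RHS]integral_mkcond.
  apply: ae_eq_integral => //.
  - by apply/(measurable_restrictT _ matom); exact: measurable_funTS.
  - apply/(measurable_restrictT _ mC); apply: measurable_funTS.
    apply/measurable_EFinP; apply: (@measurableT_comp _ _ _ _ _ _ h) => //.
  - apply: filterS descends_ae => v dv _; rewrite !patchE.
    case: (boolP (v \in atom X n w)) => [|]; rewrite ?inE ?notin_setE.
      by move=> av; rewrite mem_set ?fh //; exact: atomC.
    move=> nav; case: (boolP (v \in _)) => //; rewrite inE => Cv.
    rewrite ht // ltnNge; apply/negP => tm; apply: nav; exact/atomE.
have eP : (P (atom X n w) = P C * (tail_prob p t)%:E)%E.
  rewrite -wsum_tail // -(atom_int (cst 1%E)) //; first by rewrite integral_cst // mul1e.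
    by move=> k kt; rewrite leqNgt kt.
  move=> v dv av; rewrite ((atomE v dv (atomC v av)).1 av) //.
have eI : (\int[P]_(v in atom X n w) sigma (traj X v) n =
    P C * wsum (fun k => (k - t)%:R) p)%E.
  apply: atom_int => //; first exact: measurable_sigma.
    by move=> k kt; rewrite (eqP (ltnW kt : k - t == 0)%N).
  move=> v dv av; rewrite [LHS](sigma_descends dv).
  have tm := (atomE v dv (atomC v av)).1 av.
  have -> : n.+1 = (z.+1 + t)%N by rewrite /z; lia.
  by rewrite (descends_sub dv).
have PCf : P C \is a fin_num by exact: fin_num_measure.
have tail0 : 0 <= tail_prob p t.
  by apply: fine_ge0; apply: nneseries_ge0 => i _ _; rewrite lee_fin.
have PC0 : 0 <= fine (P C) by exact: fine_ge0.
(* A non-null atom forces both [P C] and the tail mass to be nonzero, and [P C] then cancels in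
   [theta]. *)
rewrite eP -[P C]fineK // -EFinM eqe mulf_eq0 negb_or in Pw.
have [c0 t0] := andP Pw.
split; first by rewrite lt_def t0.
rewrite /theta /cond_exp eI eP -[P C]fineK //.
rewrite -(fineK (wsum_residual_fin p_dist p_mean t)) -!EFinM /=; congr EFin.
by rewrite /residual_mean; field; rewrite c0 t0.
Qed.

(** Binary words of length [n.+1] are countable in number, so the null atoms have null union. This
    discards the trajectories on which [cond_exp] would divide by zero. *)
Lemma atom_neq0_ae : {ae P, forall w n, P (atom X n w) != 0%E}.
Proof.
apply: ae_foralln => n.
have mX i : fiber_measurable (X i).
  exact: (fiber_measurable_comp (fun k => k != 0%N) (chain_fibers M i)).
have := ae_fiber_neq0 P (fiber_measurable_path n.+1 mX).
apply: filterS => w; rewrite (_ : _ @^-1` _ = atom X n w) //.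
apply/seteqP; split=> v /=.
  move=> e i iN; have := congr1 (nth false ^~ i) e.
  by rewrite !nth_mkseq.
move=> av; apply: (@eq_from_nth _ false); first by rewrite !size_mkseq.
by move=> i; rewrite size_mkseq => iN; rewrite !nth_mkseq // av.
Qed.

End Renewal.

Theorem theorem3 (R : realType) (d : measure_display) (T : measurableType d)
    (P : probability T R) (p : nat -> R) (X : nat -> T -> bool)
    (p_dist : prob_dist p) (p_mean : finite_mean p)
    (X_renewal : binary_renewal_process P p X) :
  {ae P, forall w : T, exists D : set nat,
    [/\ (#|[pred i : 'I_n.+1 | (i : nat) \in D]|%:R / n.+1%:R : R)
          @[n --> \oo] --> (1 : R),
        `|est_mean (traj X w) n - theta P X n w|%E
          @[n --> within D \oo] --> 0%E &
        (\sum_(0 <= l <oo)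
           (`|est_prob (R := R) (traj X w) n l -
              p (l + tau (traj X w) n)%N /
                tail_prob p (tau (traj X w) n)|)%:E)%E
          @[n --> within D \oo] --> 0%E]}.
Proof.
have [pi [M [pi_stat M_chain XM]]] := X_renewal.
have -> : X = fun n w => M n w != 0%N by apply/funext => n; apply/funext => w.
have dyn := descends_ae p_dist M_chain.
have rare := above_rare_ae (renewal_kernel_ge0 p_dist) pi_stat M_chain.
have freq := ae_foralln (runs_freq_ae p_dist M_chain).
have atoms := atom_neq0_ae M.
apply: filterS2 (filterI dyn rare) (filterI freq atoms) => w [dw rw] [fw aw].
apply: (estimators_converge p_dist p_mean dw rw fw) => n psin.
apply: (theta_renewal p_dist p_mean M_chain dw (aw n) psin).
Qed.
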